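(* Let $u$ be the solution to the obstacle problem in $\mathcal K_{g,h}(\Omega,\Omega')$. If a ball $B_r\subset\Omega$ is such that $$\operatorname*{ess\,inf}_{B_r}(u-h)>0,$$ then $u$ is a weak solution to $\mathcal Lu=0$ in $B_r$. In particular, if $u$ is lower semicontinuous and $h$ is upper semicontinuous in $\Omega$, then $u$ is a weak solution to $\mathcal Lu=0$ in $\Omega_+:=\{x\in\Omega:u(x)>h(x)\}$.
   Context: Fix $s\in(0,1)$, $p\in(1,\infty)$, $\Lambda\ge 1$, and a measurable symmetric kernel $K:\mathbb R^n\times\mathbb R^n\to[0,\infty)$, $K(x,y)=K(y,x)$, with $\Lambda^{-1}\le K(x,y)|x-y|^{n+sp}\le\Lambda$ for a.e. $x,y\in\mathbb R^n$. Write $L(a,b):=|a-b|^{p-2}(a-b)$ for $a,b\in\mathbb R$ (with $L(a,a)=0$). Formally, $\mathcal L u(x)=\mathrm{p.v.}\int_{\mathbb R^n}K(x,y)L(u(x),u(y))\,dy$. For open $U\subset\mathbb R^n$, $W^{s,p}(U)$ is the fractional Sobolev space with norm $\|v\|_{L^p(U)}+\left(\int_U\int_U\frac{|v(x)-v(y)|^p}{|x-y|^{n+sp}}\,dx\,dy\right)^{1/p}$. The tail space is $L^{p-1}_{sp}(\mathbb R^n):=\{f\in L^{p-1}_{\rm loc}(\mathbb R^n):\int_{\mathbb R^n}|f(x)|^{p-1}(1+|x|)^{-n-sp}\,dx<\infty\}$. For an open set $U$, a function $u\in W^{s,p}_{\rm loc}(U)\cap L^{p-1}_{sp}(\mathbb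 R^n)$ is a weak supersolution to $\mathcal Lu=0$ in $U$ if $\int_{\mathbb R^n}\int_{\mathbb R^n}L(u(x),u(y))(\eta(x)-\eta(y))K(x,y)\,dx\,dy\ge0$ for every nonnegative $\eta\in C_0^\infty(U)$; it is a weak subsolution if $-u$ is a weak supersolution, and a weak solution if it is both a weak sub- and supersolution. Obstacle problem. Let $\Omega\Subset\Omega'$ be open bounded subsets of $\mathbb R^n$, let $h:\mathbb R^n\to[-\infty,\infty)$ be an extended real-valued function (the obstacle), and let $g\in W^{s,p}(\Omega')\cap L^{p-1}_{sp}(\mathbb R^n)$ (the boundary values). Define $$\mathcal K_{g,h}(\Omega,\Omega'):=\{u\in W^{s,p}(\Omega'): u\ge h\text{ a.e. in }\Omega,\ u=g\text{ a.e. on }\mathbb R^n\setminus\Omega\}.$$ For $u\in\mathcal K_{g,h}(\Omega,\Omega')$ and $v\in W^{s,p}(\Omega')$ let $$\mathcal Au(v):=\int_{\Omega'}\int_{\Omega'}L(u(x),u(y))(v(x)-v(y))K(x,y)\,dx\,dy+2\int_{\mathbb R^n\setminus\Omega'}\int_\Omega L(u(x),g(y))v(x)K(x,y)\,dx\,dy,$$ where in the second term $x\in\Omega$ and $y\in\mathbb R^n\setminus\Omega'$. A function $u\in\mathcal K_{g,h}(\Omega,\Omega')$ is a solution to the obstacle problem in $\mathcal K_{g,h}(\Omega,\Omega')$ if $\mathcal Au(v-u)\ge0$ whenever $v\in\mathcal K_{g,h}(\Omega,\Omega')$; the set $\mathcal K_{g,h}(\Omega,\Omega')$ is assumed non-empty.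 *)

(* Defs.v *)
(* MathComp-Analysis, over an arbitrary R : realType. *)
From HB Require Import structures.
From mathcomp Require Import all_boot all_order all_algebra.
From mathcomp Require Import all_classical all_reals all_analysis.
From mathcomp Require Import measurable_realfun.

Set Implicit Arguments.
Unset Strict Implicit.
Unset Printing Implicit Defensive.
Import Order.TTheory GRing.Theory Num.Theory.
Import numFieldNormedType.Exports.

Local Open Scope classical_set_scope.
Local Open Scope ring_scope.

(* R^n is 'rV[R]_n. Its sigma-algebra is the one generated by the coordinate
   maps (as the library does for n.-tuple), i.e. the Borel one. *)
Definition rV_display : measure_display. Proof. exact: default_measure_display. Qed.

Section measurable_rV.
Context (R : realType) (n : nat).

Definition rV_coord (i : 'I_n) (x : 'rV[R]_n) : measurableTypeR R := x ord0 i.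

Let rV_set0 : g_sigma_preimage rV_coord set0.
Proof. exact: sigma_algebra0. Qed.

Let rV_setC A : g_sigma_preimage rV_coord A -> g_sigma_preimage rV_coord (~` A).
Proof. exact: sigma_algebraC. Qed.

Let rV_bigcup (F : (set 'rV[R]_n)^nat) :
  (forall i, g_sigma_preimage rV_coord (F i)) ->
  g_sigma_preimage rV_coord (\bigcup_i (F i)).
Proof. exact: sigma_algebra_bigcup. Qed.

HB.instance Definition _ := @isMeasurable.Build rV_display
  'rV[R]_n (g_sigma_preimage rV_coord) rV_set0 rV_setC rV_bigcup.

Lemma measurable_rV_coord i : measurable_fun setT (rV_coord i).
Proof.
move=> _ Y mY; rewrite setTI; apply: sub_sigma_algebra => /=.
rewrite -bigcup_seq/=; exists i => /=; first by rewrite mem_index_enum.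
by exists Y => //; rewrite setTI.
Qed.

Lemma measurable_fun_rV d (T : measurableType d) (f : T -> 'rV[R]_n) :
  (forall i, measurable_fun setT (rV_coord i \o f)) -> measurable_fun setT f.
Proof.
move=> mf _; suff H : (measurable : set (set 'rV[R]_n)) `<=`
    [set Y | measurable (setT `&` f @^-1` Y)] by move=> Y /H.
apply: smallest_sub; last move=> A.
  split=> /=; first by rewrite preimage_set0 setI0.
  - by move=> A; rewrite !setTI setTD preimage_setC => mA; exact: measurableC.
  - move=> F mF; rewrite preimage_bigcup setI_bigcupr.
    by apply: bigcup_measurable => k _; exact: mF.
rewrite -bigcup_seq => -[i _] [B mB BA] /=; rewrite -BA.
by have := mf i measurableT B mB; rewrite !setTI.
Qed.

End measurable_rV.

(* Lebesgue measure on R^n by iterated products, transported along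
   R * R^n -> R^(n+1); lebesgue_rV_box gives the volume of boxes. *)
Section lebesgue_rV.
Context (R : realType).

Definition rV_cons n (z : measurableTypeR R * 'rV[R]_n) : 'rV[R]_n.+1 :=
  row_mx (z.1)%:M z.2.

Lemma rV_cons0 n z : @rV_cons n z ord0 ord0 = z.1.
Proof.
by rewrite /rV_cons mxE; case: splitP => // j; rewrite [j]ord1 mxE eqxx.
Qed.

Lemma rV_consS n z i : @rV_cons n z ord0 (lift ord0 i) = z.2 ord0 i.
Proof.
rewrite /rV_cons mxE; case: splitP => j /=; first by rewrite [j]ord1.
by rewrite /bump leq0n !add1n => -[/val_inj->].
Qed.

Lemma measurable_rV_cons n : measurable_fun setT (@rV_cons n).
Proof.
apply: measurable_fun_rV => i; case: (unliftP ord0 i) => [j ->|->].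
- rewrite (_ : _ \o _ = rV_coord j \o snd).
    by apply: measurableT_comp => //; exact: measurable_rV_coord.
  by apply/funext => z; exact: rV_consS.
- by rewrite (_ : _ \o _ = fst)//; apply/funext => z; exact: rV_cons0.
Qed.

Definition rV_uncons n (x : 'rV[R]_n.+1) : measurableTypeR R * 'rV[R]_n :=
  (x ord0 ord0, \row_i x ord0 (lift ord0 i)).

Lemma rV_consK n : cancel (@rV_cons n) (@rV_uncons n).
Proof.
move=> [t v]; rewrite /rV_uncons rV_cons0; congr pair.
by apply/rowP => i; rewrite mxE rV_consS.
Qed.

Lemma measurable_rV_uncons n : measurable_fun setT (@rV_uncons n).
Proof.
apply/measurable_fun_pairP; split; first exact: (measurable_rV_coord ord0).
apply: measurable_fun_rV => i.
rewrite (_ : _ \o _ = rV_coord (lift ord0 i)); first exact: measurable_rV_coord.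
by apply/funext => x /=; rewrite /rV_coord mxE.
Qed.

Section step.
Context (n : nat) (mu : {sigma_finite_measure set 'rV[R]_n -> \bar R}).

Definition lebesgue_rVS : set 'rV[R]_n.+1 -> \bar R :=
  pushforward (lebesgue_measure \x mu)%E (@rV_cons n).

Let mcons A : measurable A -> measurable (@rV_cons n @^-1` A).
Proof. by move=> mA; rewrite -[X in measurable X]setTI; exact: measurable_rV_cons. Qed.

Let lebesgue_rVS0 : lebesgue_rVS set0 = 0%E.
Proof. by rewrite /lebesgue_rVS /pushforward preimage_set0 measure0. Qed.

Let lebesgue_rVS_ge0 A : (0 <= lebesgue_rVS A)%E.
Proof. exact: (measure_ge0 (lebesgue_measure \x mu)%E). Qed.

Let lebesgue_rVS_sigma_additive : semi_sigma_additive lebesgue_rVS.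
Proof.
move=> F mF tF mUF; rewrite /lebesgue_rVS /pushforward preimage_bigcup.
apply: (measure_semi_sigma_additive (s := (lebesgue_measure \x mu)%E)).
- by move=> k; apply: mcons; exact: mF.
- apply/trivIsetP => /= i j _ _ ij; rewrite -preimage_setI.
  by move/trivIsetP : tF => /(_ _ _ _ _ ij) ->//; rewrite preimage_set0.
- by rewrite -preimage_bigcup; exact: mcons.
Qed.

HB.instance Definition _ := isMeasure.Build _ _ _ lebesgue_rVS
  lebesgue_rVS0 lebesgue_rVS_ge0 lebesgue_rVS_sigma_additive.

Let lebesgue_rVS_sigma_finite : sigma_finite setT lebesgue_rVS.
Proof.
have /sigma_finiteP[F [FT ndF Foo]] := sigma_finiteT (@lebesgue_measure R).
have /sigma_finiteP[G [GT ndG Goo]] := sigma_finiteT mu.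
exists (fun k => @rV_uncons n @^-1` (F k `*` G k)).
  rewrite -preimage_bigcup (_ : \bigcup_k _ = setT) ?preimage_setT//.
  apply/seteqP; split => // -[t v] _.
  have [i _ Fi] : (\bigcup_k F k) t by rewrite -FT.
  have [j _ Gj] : (\bigcup_k G k) v by rewrite -GT.
  exists (maxn i j) => //; split => /=.
    by have /ndF/subsetPset := leq_maxl i j; apply.
  by have /ndG/subsetPset := leq_maxr i j; apply.
move=> k; have [mF Fk] := Foo k; have [mG Gk] := Goo k; split.
  rewrite -[X in measurable X]setTI; apply: measurable_rV_uncons => //.
  exact: measurableX.
rewrite /lebesgue_rVS /pushforward -comp_preimage.
rewrite (_ : _ \o _ = id); last by apply/funext => z; exact: rV_consK.
by rewrite preimage_id product_measure1E// lte_mul_pinfty// ge0_fin_numE.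
Qed.

HB.instance Definition _ := Measure_isSigmaFinite.Build _ _ _ lebesgue_rVS
  lebesgue_rVS_sigma_finite.
End step.

Fixpoint lebesgue_rV n : {sigma_finite_measure set 'rV[R]_n -> \bar R} :=
  if n is m.+1 then lebesgue_rVS (lebesgue_rV m) else \d_(0 : 'rV[R]_0).

Lemma lebesgue_rV_box n (a b : 'rV[R]_n) : (forall i, a ord0 i <= b ord0 i) ->
  lebesgue_rV n [set x : 'rV[R]_n | forall i, x ord0 i \in `[a ord0 i, b ord0 i]] =
  (\prod_(i < n) (b ord0 i - a ord0 i))%:E.
Proof.
elim: n a b => [|n IHn] a b ab /=.
  by rewrite big_ord0 diracE mem_set// => -[].
pose a' : 'rV[R]_n := (rV_uncons a).2; pose b' := (rV_uncons b).2.
have mbox m (c d : 'rV[R]_m) :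
    measurable [set x : 'rV[R]_m | forall i, x ord0 i \in `[c ord0 i, d ord0 i]].
  rewrite (_ : [set _ | _] = \bigcap_(i in [set: 'I_m])
      @rV_coord R m i @^-1` `[c ord0 i, d ord0 i]%classic); last first.
    by apply/seteqP; split => x /= H i; have := H i; [move=> ? _|exact].
  apply: fin_bigcap_measurable => // i _.
  rewrite -[X in measurable X]setTI.
  by apply: measurable_rV_coord => //; exact: measurable_itv.
have consE : @rV_cons n @^-1`
      [set x : 'rV[R]_n.+1 | forall i, x ord0 i \in `[a ord0 i, b ord0 i]] =
    `[a ord0 ord0, b ord0 ord0]%classic `*`
    [set x : 'rV[R]_n | forall i, x ord0 i \in `[a' ord0 i, b' ord0 i]].
  apply/seteqP; split => -[t v] /=.
    move=> H; split; first by have := H ord0; rewrite rV_cons0.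
    by move=> i; have := H (lift ord0 i); rewrite rV_consS !mxE.
  move=> [ht hv] i; case: (unliftP ord0 i) => [j ->|->].
    by have := hv j; rewrite rV_consS !mxE.
  by rewrite rV_cons0.
transitivity ((lebesgue_measure \x lebesgue_rV n)%E
    (`[a ord0 ord0, b ord0 ord0]%classic `*`
     [set x : 'rV[R]_n | forall i, x ord0 i \in `[a' ord0 i, b' ord0 i]])).
  by rewrite -consE.
rewrite product_measure1E ?measurable_itv//; last exact: mbox.
rewrite IHn; last by move=> i; rewrite !mxE.
rewrite big_ord_recl EFinM.
congr (_ * _)%E; last by congr (_%:E); apply: eq_bigr => i _; rewrite !mxE.
etransitivity; first exact: lebesgue_measure_itv.
rewrite /= lte_fin; have [//|] := ltP (a ord0 ord0) (b ord0 ord0).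
by move=> ba; rewrite (@le_anti _ _ (a ord0 ord0) (b ord0 ord0)) ?subrr// ab ba.
Qed.

End lebesgue_rV.

(* Measurability with respect to the completion of mu, i.e. Lebesgue
   measurability when mu is a Lebesgue measure. *)
Definition completed_measurable_fun d (T : measurableType d) (R : realType)
    (mu : set T -> \bar R) (D : set T) (f : T -> R) :=
  forall Y : set R, measurable Y -> completed_algebra_gen mu (D `&` f @^-1` Y).

(* ess_inf mu, with the a.e. condition restricted to D. *)
Definition ess_inf_on d (T : measurableType d) (R : realType)
    (mu : {measure set T -> \bar R}) (D : set T) (f : T -> \bar R) : \bar R :=
  ereal_sup [set y | {ae mu, forall x, D x -> (y <= f x)%E}].

Section euclidean_space.
Context (R : realType) (n : nat).
Implicit Types (U V : set 'rV[R]_n) (x : 'rV[R]_n).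

(* The library norm on 'rV[R]_n is the max norm (same topology). *)
Definition enorm x : R := Num.sqrt (\sum_(i < n) x ord0 i ^+ 2).

Definition eball x (r : R) : set 'rV[R]_n := [set y | enorm (y - x) < r].

Definition compactly_contained V U := compact (closure V) /\ closure V `<=` U.

(* Partial derivatives up to order k exist everywhere and are continuous. *)
Fixpoint Ck (k : nat) (f : 'rV[R]_n -> R) : Prop :=
  continuous f /\
  if k is k'.+1 then
    forall i : 'I_n, (forall x, derivable f x (delta_mx ord0 i)) /\
                     Ck k' (fun x => 'D_(delta_mx ord0 i) f x)
  else True.

(* C_0^oo(U) *)
Definition test_function U (eta : 'rV[R]_n -> R) :=
  (forall k, Ck k eta) /\ compactly_contained [set x | eta x != 0] U.

End euclidean_space.

Section obstacle_problem.
Context (R : realType) (n : nat) (s p : R).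
Implicit Types (u v g f eta : 'rV[R]_n -> R) (h : 'rV[R]_n -> \bar R).
Implicit Types (U V Om : set 'rV[R]_n) (K : 'rV[R]_n -> 'rV[R]_n -> R).

Local Notation mu := (lebesgue_rV R n).
Local Notation mu2 := (mu \x mu)%E.

Definition admissible_kernel (Lam : R) K :=
  [/\ forall x y, 0 <= K x y,
      forall x y, K x y = K y x,
      completed_measurable_fun mu2 setT (fun z => K z.1 z.2) &
      {ae mu2, forall z,
        Lam^-1 <= K z.1 z.2 * enorm (z.1 - z.2) `^ (n%:R + s * p) <= Lam}].

(* L(a,b) = |a-b|^(p-2) (a-b); the second factor gives L(a,a) = 0 for all p. *)
Definition Lpow (a b : R) : R := `|a - b| `^ (p - 2) * (a - b).

(* On the diagonal the second integrand is 0 / 0 = 0. *)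
Definition Wsp_norm U v : \bar R :=
  ((\int[mu]_(x in U) (`|v x| `^ p)%:E) `^ p^-1 +
   (\int[mu2]_(z in U `*` U)
      (`|v z.1 - v z.2| `^ p / enorm (z.1 - z.2) `^ (n%:R + s * p))%:E)
     `^ p^-1)%E.

Definition Wsp U v :=
  completed_measurable_fun mu U v /\ (Wsp_norm U v < +oo)%E.

Definition Wsp_loc U v :=
  forall V, open V -> compactly_contained V U -> Wsp V v.

(* L^{p-1}_{sp}(R^n) *)
Definition tail_space f :=
  [/\ completed_measurable_fun mu setT f,
      forall C, compact C -> (\int[mu]_(x in C) (`|f x| `^ (p - 1))%:E < +oo)%E &
      (\int[mu]_x (`|f x| `^ (p - 1) *
                   (1 + enorm x) `^ (- n%:R - s * p))%:E < +oo)%E].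

Definition weak_supersolution K U u :=
  [/\ open U, Wsp_loc U u, tail_space u &
      forall eta, test_function U eta -> (forall x, 0 <= eta x) ->
        (0 <= \int[mu2]_z
                (Lpow (u z.1) (u z.2) * (eta z.1 - eta z.2) * K z.1 z.2)%:E)%E].

Definition weak_subsolution K U u := weak_supersolution K U (fun x => - u x).

Definition weak_solution K U u :=
  weak_subsolution K U u /\ weak_supersolution K U u.

Definition obstacle_class g h Om (Om' : set 'rV[R]_n) : set ('rV[R]_n -> R) :=
  [set u | [/\ Wsp Om' u,
               {ae mu, forall x, Om x -> (h x <= (u x)%:E)%E} &
               {ae mu, forall x, ~ Om x -> u x = g x}]].

Definition Aform K g Om (Om' : set 'rV[R]_n) u v : \bar R :=
  (\int[mu2]_(z in Om' `*` Om')
     (Lpow (u z.1) (u z.2) * (v z.1 - v z.2) * K z.1 z.2)%:E +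
   2%:E * \int[mu2]_(z in Om `*` ~` Om')
     (Lpow (u z.1) (g z.2) * v z.1 * K z.1 z.2)%:E)%E.

Definition obstacle_solution K g h Om (Om' : set 'rV[R]_n) u :=
  obstacle_class g h Om Om' u /\
  forall v, obstacle_class g h Om Om' v ->
    (0 <= Aform K g Om Om' u (fun x => (v x - u x)%R))%E.

End obstacle_problem.

Definition lsc_on (T : topologicalType) (R : realType) (D : set T)
    (f : T -> \bar R) :=
  lower_semicontinuous (f : subspace D -> \bar R).

Definition usc_on (T : topologicalType) (R : realType) (D : set T)
    (f : T -> \bar R) :=
  lsc_on D (fun x => (- f x)%E).

(* Main.v *)
Require Import Defs.
From mathcomp Require Import all_boot all_order all_algebra.
From mathcomp Require Import all_classical all_reals all_analysis.
From mathcomp Require Import measurable_realfun ring lra.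
Import Order.TTheory GRing.Theory Num.Theory.
Import numFieldNormedType.Exports.
Local Open Scope classical_set_scope.
Local Open Scope ring_scope.
Set Implicit Arguments.
Unset Strict Implicit.
Unset Printing Implicit Defensive.

(** Where u stays at a positive distance above the obstacle, small perturbations of
    either sign remain competitors: if eta is a test function and u >= h + dlt
    a.e. where eta does not vanish, then both u + eps eta and u - eps eta are
    admissible for small eps > 0. Inserting them into the
    variational inequality and dividing by eps gives both signs of the weak
    formulation. On a ball the gap dlt is the hypothesis on the essential infimum;
    on the open noncontact set {u > h} it follows from semicontinuity and the
    compactness of the support of eta (compact_gap).

    Three points need work. First, u + eps eta must belong to W^{s,p}(Om'), that
    is, a smooth function must have finite Gagliardo energy on a bounded set. A
    C^1 function is Lipschitz on cubes (Ck1_lipschitz_cube), and Lipschitz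
    functions have finite energy (gagliardo_lipschitz_lty), by summing over dyadic
    distances from the diagonal.

    Secondly, the inequality of the obstacle problem concerns an integral over
    Om' x Om' plus twice an integral over Om x ~Om', while the weak formulation
    integrates over the whole product. By the symmetry of the kernel the two agree
    (integral_symmetric_split). This is an identity between extended real
    integrals, with the convention +oo - +oo = -oo: the positive and the negative
    part of the integrand split separately. So the sign of the form passes to the
    full double integral.

    Thirdly, the data are Lebesgue measurable, whereas additivity and Tonelli's
    theorem hold for Borel functions. Every completed measurable function has a
    Borel version (completed_measurable_fun_borel), and integrals, being suprema
    over simple minorants, only see functions up to null sets
    (ae_eq_lower_integral). *)

(** * Lower integrals and completed measurability *)

Section lower_integral.
Local Open Scope ereal_scope.
Context d (T : measurableType d) (R : realType) (mu : {measure set T -> \bar R}).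
Implicit Types (D : set T) (f g : T -> \bar R).
Import HBNNSimple.

(** The integral of a nonnegative function is a supremum over measurable simple
    minorants, so it is monotone on all functions, measurable or not: cutting a
    minorant off on a null set does not change its integral. This is what allows
    Lebesgue measurable integrands to be exchanged for Borel ones. *)
Lemma ge0_ae_le_integral D f g :
  (forall x, D x -> 0 <= f x) -> (forall x, D x -> 0 <= g x) ->
  {ae mu, forall x, D x -> f x <= g x} ->
  \int[mu]_(x in D) f x <= \int[mu]_(x in D) g x.
Proof.
move=> f0 g0 [N [mN N0 fgN]].
rewrite integral_mkcond [leRHS]integral_mkcond.
have r0 k : (forall x, D x -> 0 <= k x) -> forall x, 0 <= (k \_ D) x.
  by move=> k0 x; rewrite patchE; case: ifPn => // /set_mem /k0.
rewrite !ge0_integralTE; [|exact: r0|exact: r0].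
apply: ge_ereal_sup => _ [h /= hf <-].
rewrite -integralT_nnsfun (ge0_negligible_integral mN)//; last 2 first.
- exact/measurable_EFinP.
- by move=> x _; rewrite lee_fin.
have mCN : measurable (~` N) by exact: measurableC.
rewrite setTD integral_nnsfun//.
apply: ereal_sup_ubound; exists (proj_nnsfun h mCN) => /=; last first.
  by rewrite (mrestrict h mCN).
(* The minorant, set to 0 on the null set N, lies below g everywhere. *)
move=> x; rewrite mindicE; case: (boolP (x \in ~` N)) => [/set_mem xN|_]; last first.
  by rewrite mulr0; exact: r0.
rewrite mulr1; apply: (le_trans (hf x)); rewrite !patchE; case: ifPn => // /set_mem Dx.
by move/subsetCl : fgN => /(_ _ xN); exact.
Qed.

Lemma ae_eq_lower_integral D f g :
  {ae mu, forall x, D x -> f x = g x} ->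
  \int[mu]_(x in D) f x = \int[mu]_(x in D) g x.
Proof.
move=> fg; rewrite integralE [RHS]integralE; congr (_ - _); apply/eqP;
  rewrite eq_le !ge0_ae_le_integral//;
  apply: filterS fg => x fg /fg; rewrite ?funeposE ?funenegE => ->//.
Qed.

End lower_integral.

Section completed_measurability.
Context d (T : measurableType d) (R : realType) (mu : {measure set T -> \bar R}).
Implicit Types (D : set T) (f g : T -> R).

(** Countably many superlevel sets, those at rational levels, determine the
    function; discarding the null sets by which they differ from measurable sets
    leaves a measurable function. *)
Lemma completed_measurable_fun_borel D f : measurable D ->
  completed_measurable_fun mu D f ->
  exists2 g, measurable_fun setT g & {ae mu, forall x, D x -> f x = g x}.
Proof.
move=> mD mf.
have H (q : rat) : exists A, exists N,
    [/\ measurable A, measurable N, mu N = 0%E &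
     forall x, ~ N x -> (D x /\ ratr q < f x) <-> A x].
  have [A mA [N [M [mM M0 NM]]] ANE] := mf _ (measurable_itv `]ratr q, +oo[).
  exists A, M; split=> // x Mx.
  have E : (D `&` f @^-1` `]ratr q, +oo[) x <-> (A `|` N) x by rewrite ANE.
  move: E; rewrite /= in_itv/= andbT => E; split.
    by move=> /E[//|/NM].
  by move=> Ax; apply/E; left.
have [A /(_ _)/cid-/all_sig[N HA]] := choice H.
pose M := \bigcup_(i : nat) (if unpickle i is Some q then N q else set0).
have mM : measurable M.
  by apply: bigcupT_measurable => i; case: unpickle => // q; have [] := HA q.
have M0 : mu M = 0%E.
  apply/negligibleP => //; apply: negligible_bigcup => i.
  case: unpickle => [q|]; last exact: negligible_set0.
  by have [_ mN N0 _] := HA q; apply/negligibleP.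
have NM q : N q `<=` M by move=> x Nx; exists (pickle q); [by []|rewrite pickleK].
exists (f \_ (D `\` M)); last first.
  exists M; split => // x /= /not_implyP[Dx]; rewrite patchE; case: ifPn => // /negP.
  by move=> + _; apply: contra_notP => Mx; rewrite inE.
apply/measurable_restrict => //; first exact: measurableD.
rewrite setTI.
apply: (measurability _ (RGenOInfty.measurableE R)).

move=> _ [_ [a ->] <-].
have -> : (D `\` M) `&` f @^-1` `]a, +oo[ =
   \bigcup_(i : nat) (if unpickle i is Some q then
      if (a < ratr q) then A q `\` M else set0 else set0).
  apply/seteqP; split => x /=.
    rewrite in_itv/= andbT => -[[Dx Mx]] /rat_in_itvoo[q].
    rewrite in_itv/= => /andP[aq qf]; exists (pickle q); first by [].
    rewrite pickleK aq; split=> //; have [_ _ _ <-//] := HA q.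
    by move=> /NM.
  move=> [i _]; case: unpickle => // q; case: ifPn => // aq [Ax Mx].
  have [_ _ _ E] := HA q; have [Dx qf] : D x /\ ratr q < f x.
    by apply/E => // /NM.
  by split=> //; rewrite in_itv/= andbT (lt_trans aq).
apply: bigcupT_measurable => i; case: unpickle => // q; case: ifPn => // _.
by apply: measurableD => //; have [] := HA q.
Qed.

Lemma borel_completed_measurable_fun D f g : measurable D ->
  measurable_fun setT g -> {ae mu, forall x, D x -> f x = g x} ->
  completed_measurable_fun mu D f.
Proof.
move=> mD mg [N [mN N0 fgN]] Y mY.
have fg x : D x -> ~ N x -> f x = g x.
  by move=> Dx Nx; move/subsetCl : fgN => /(_ _ Nx); exact.
exists ((D `&` g @^-1` Y) `\` N).
  apply: measurableD => //; apply: measurableI => //.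
  by rewrite -[X in measurable X]setTI; exact: mg.
exists ((D `&` f @^-1` Y) `&` N); first by exists N; split=> // x [].
apply/seteqP; split => x /=.
  by move=> [[[Dx gY] Nx]|[]//]; split=> //; rewrite fg.
move=> [Dx fY]; have [Nx|Nx] := pselect (N x); [by right|left].
by rewrite -fg.
Qed.

End completed_measurability.

(** * Null sets and symmetry of product measures *)

Section product_null_sets.
Local Open Scope ereal_scope.
Context d1 d2 (T1 : measurableType d1) (T2 : measurableType d2) (R : realType).
Variable m1 : {sigma_finite_measure set T1 -> \bar R}.
Variable m2 : {sigma_finite_measure set T2 -> \bar R}.

Lemma ae_fst (P : T1 -> Prop) :
  {ae m1, forall x, P x} -> {ae (m1 \x m2), forall z, P z.1}.
Proof.
move=> [N [mN N0 PN]]; exists (N `*` setT); split.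
- exact: measurableX.
- by rewrite product_measure1E//; apply: eq_trans (mul0e _); congr (_ * _).
- by move=> [x y] /= Px; split => //; apply: PN.
Qed.

Lemma ae_snd (P : T2 -> Prop) :
  {ae m2, forall x, P x} -> {ae (m1 \x m2), forall z, P z.2}.
Proof.
move=> [N [mN N0 PN]]; exists (setT `*` N); split.
- exact: measurableX.
- by rewrite product_measure1E//; apply: eq_trans (mule0 _); congr (_ * _).
- by move=> [x y] /= Px; split => //; apply: PN.
Qed.

End product_null_sets.

Section product_swap.
Local Open Scope ereal_scope.
Context d (T : measurableType d) (R : realType).
Variable m : {sigma_finite_measure set T -> \bar R}.

(** Tonelli's theorem in both orders: the measure m \x m is invariant under the
    exchange of the two variables. *)
Lemma integral_swap (f : T * T -> \bar R) : measurable_fun setT f ->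
  (forall z, 0 <= f z) ->
  \int[m \x m]_z f z = \int[m \x m]_z f (z.2, z.1).
Proof.
move=> mf f0; rewrite fubini_tonelli1// fubini_tonelli2//.
by apply: measurableT_comp => //; exact: measurable_swap.
Qed.

Lemma ae_swap (P : T * T -> Prop) :
  {ae (m \x m), forall z, P z} -> {ae (m \x m), forall z, P (z.2, z.1)}.
Proof.
move=> [N [mN N0 PN]].
have mS : measurable ((fun z : T * T => (z.2, z.1)) @^-1` N).
  rewrite -[X in measurable X]setTI.
  exact: (measurable_swap measurableT mN).
exists ((fun z => (z.2, z.1)) @^-1` N); split => //; last first.
  by move=> [x y] /= Px; apply: PN.
have := @integral_indic _ _ _ (m \x m) _ measurableT _ mS.
rewrite setIT => <-.
have N0' : \int[m \x m]_z (\1_N z)%:E = 0.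
  by rewrite integral_indic// setIT; exact: N0.
rewrite -[RHS]N0' [RHS]integral_swap//.
exact/measurable_EFinP/measurable_indic.
Qed.

End product_swap.

(** * Borel structure and Lebesgue measure of the space of row vectors *)

Section borel_rV.
Context (R : realType) (n : nat).
Local Notation mu := (lebesgue_rV R n).
Implicit Types (x y : 'rV[R]_n) (U : set 'rV[R]_n).

Lemma measurable_rV_entry i : measurable_fun setT (fun x => x ord0 i).
Proof. exact: (@measurable_rV_coord R n i). Qed.

Lemma measurable_rV_ball x e : measurable (ball x e).
Proof.
have [e0|e0] := ltP 0 e; last first.
  rewrite (_ : ball x e = set0) ?measurable0//; apply/seteqP; split => // y.
  by rewrite mx_norm_ball/= => /(le_lt_trans (normr_ge0 _)); rewrite ltNge e0.
rewrite (_ : ball x e = \bigcap_(i in [set: 'I_n])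
    (fun y : 'rV[R]_n => y ord0 i) @^-1` (ball (x ord0 i) e)); last first.
  apply/seteqP; split => y; first by move=> [_ H] i _; exact: H.
  by move=> H; split => // i j; rewrite [i]ord1; exact: H.
apply: fin_bigcap_measurable => // i _; rewrite -[X in measurable X]setTI.
by apply: measurable_rV_entry => //; exact: measurable_ball.
Qed.

Lemma rV_rat_dense x e : 0 < e -> exists q : 'rV[rat]_n, ball (map_mx ratr q : 'rV[R]_n) e x.
Proof.
move=> e0; have H i : exists q : rat, ball (ratr q : R) e (x ord0 i).
  have : x ord0 i - e < x ord0 i + e by rewrite ltrBlDr -addrA ltrDl addr_gt0.
  move=> /rat_in_itvoo[q]; rewrite in_itv/= => /andP[h1 h2]; exists q.
  by rewrite /ball/= ltr_norml; apply/andP; split; lra.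
have [q Hq] := choice H; exists (\row_i q i); split => // i j.
by rewrite !mxE [i]ord1; exact: Hq.
Qed.

(** An open set is a countable union of balls with rational centers and radii
    1 / (m + 1), and balls of the max norm are boxes. *)
Lemma open_rV_measurable U : open U -> measurable U.
Proof.
move=> oU.
rewrite (_ : U = \bigcup_(k : nat) (if unpickle k is Some (q, m) then
   if `[< ball (map_mx ratr q : 'rV[R]_n) (m.+1%:R^-1) `<=` U >] then
     ball (map_mx ratr q : 'rV[R]_n) (m.+1%:R^-1) else set0 else set0)); last first.
  apply/seteqP; split => x.
    move=> Ux; have /nbhs_ballP[e /= e0 eU] : nbhs x U by exact: oU.
    have [m _ me] := near_infty_natSinv_lt (PosNum (divr_gt0 e0 (@ltr0n R 2))).
    have {}me : m.+1%:R^-1 < e / 2 := me m (leqnn m).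
    have [q qx] : exists q : 'rV[rat]_n, ball (map_mx ratr q : 'rV[R]_n) m.+1%:R^-1 x.
      by apply: rV_rat_dense; rewrite invr_gt0.
    exists (pickle (q, m)); first by [].
    rewrite pickleK; case: asboolP => // -[] y qy; apply: eU.
    have -> : e = e / 2 + e / 2 by rewrite -splitr.
    apply: (@ball_triangle _ _ (map_mx ratr q : 'rV[R]_n) x y).
      by apply: ball_sym; apply: le_ball qx; exact: ltW.
    by apply: le_ball qy; exact: ltW.
  by move=> [k _]; case: unpickle => // -[q m]; case: asboolP => // + qx; apply.
apply: bigcupT_measurable => k; case: unpickle => // -[q m]; case: asboolP => // _.
exact: measurable_rV_ball.
Qed.

Lemma closed_rV_measurable U : closed U -> measurable U.
Proof.
by move=> cU; rewrite -[U]setCK; apply: measurableC; apply: open_rV_measurable; apply: closed_openC.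
Qed.

Lemma continuous_rV_measurable_fun (f : 'rV[R]_n -> R) :
  continuous f -> measurable_fun setT f.
Proof.
move=> /continuousP cf; apply: (measurability _ (RGenOpens.measurableE R)).
move=> _ [_ [a [b ->]] <-]; rewrite setTI; apply: open_rV_measurable; apply: cf.
exact: interval_open.
Qed.

Lemma enorm_continuous : continuous (@enorm R n).
Proof.
have sumC (r : seq 'I_n) : continuous (fun x : 'rV[R]_n => \sum_(i <- r) x ord0 i ^+ 2).
  elim: r => [|i r IH] x.
    rewrite (_ : (fun _ => _) = cst 0); first exact: cst_continuous.
    by apply/funext => y; rewrite big_nil.
  rewrite (_ : (fun _ => _) = fun y : 'rV[R]_n =>
      y ord0 i ^+ 2 + \sum_(i <- r) y ord0 i ^+ 2); last first.
    by apply/funext => y; rewrite big_cons.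
  have hx : {for x, continuous (fun y : 'rV[R]_n => y ord0 i ^+ 2)}.
    apply: (@continuous_comp _ _ _ (fun y : 'rV[R]_n => y ord0 i) (fun t : R => t ^+ 2)).
      exact: coord_continuous.
    exact: exprn_continuous.
  exact: (cvgD hx (IH x)).
move=> x; apply: (@continuous_comp _ _ _ (fun x : 'rV[R]_n => \sum_(i < n) x ord0 i ^+ 2)).
  exact: sumC.
exact: sqrt_continuous.
Qed.

Lemma open_eball x r : open (eball x r).
Proof.
have -> : eball x r = (fun y => enorm (y - x)) @^-1` [set t | t < r] by [].
apply: open_comp; last exact: open_lt.
move=> y _; apply: (@continuous_comp _ _ _ (fun y => y - x)).
  exact: (@continuousB _ _ _ id (cst x) y (@cvg_id _ _) (@cst_continuous _ _ x y)).
exact: enorm_continuous.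
Qed.

Lemma enorm_ge0 x : 0 <= enorm x. Proof. exact: sqrtr_ge0. Qed.

Lemma entry_le_enorm x i : `|x ord0 i| <= enorm x.
Proof.
rewrite -sqrtr_sqr /enorm ler_wsqrtr// (bigD1 i)//= lerDl.
by apply: sumr_ge0 => j _; exact: sqr_ge0.
Qed.

Lemma enorm_le_entries x (M : R) : (forall i, `|x ord0 i| <= M) ->
  enorm x <= Num.sqrt (n%:R * M ^+ 2).
Proof.
move=> xM; rewrite /enorm ler_wsqrtr//.
apply: (@le_trans _ _ (\sum_(i < n) M ^+ 2)).
  by apply: ler_sum => i _; rewrite -real_normK ?num_real// ler_sqr ?nnegrE ?(le_trans _ (xM i)).
by rewrite sumr_const card_ord -[leLHS]mulr_natl.
Qed.

Lemma measurable_enormB :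
  measurable_fun setT (fun z : 'rV[R]_n * 'rV[R]_n => enorm (z.1 - z.2)).
Proof.
apply: (@measurableT_comp _ _ _ _ _ _ (@Num.sqrt R)).
  by apply: continuous_measurable_fun; exact: sqrt_continuous.
apply: measurable_sum => i; apply: measurable_funX.
rewrite (_ : (fun _ => _) = fun z : 'rV[R]_n * 'rV[R]_n => z.1 ord0 i - z.2 ord0 i).
  by apply: measurable_funB;
    apply: (measurableT_comp (measurable_rV_entry i)).
by apply/funext => z; rewrite !mxE.
Qed.

(** Closed balls of the max norm around 0, the convex sets on which the
    coordinatewise mean value argument is run. *)
Definition cube (M : R) : set 'rV[R]_n := [set x | forall i, `|x ord0 i| <= M].

Lemma bounded_sub_cube U : bounded_set U -> exists2 M, 0 < M & U `<=` cube M.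
Proof.
move=> [M [_ bM]]; exists (`|M| + 1); first by rewrite ltr_wpDl.
move=> x Ux i; have := bM (`|M| + 1) _ x Ux.
have -> : M < `|M| + 1 by rewrite (le_lt_trans (ler_norm _))// ltrDl.
move=> /(_ isT); apply: le_trans; rewrite [leRHS]/Num.norm/= mx_normrE.
exact: (le_bigmax _ (fun ij => `|x ij.1 ij.2|) (ord0, i)).
Qed.

Lemma lebesgue_rV_cball x (r : R) : 0 <= r ->
  mu [set y : 'rV[R]_n | forall i, `|x ord0 i - y ord0 i| <= r] = ((r *+ 2) ^+ n)%:E.
Proof.
move=> r0; rewrite [X in mu X = _](_ : _ = [set y : 'rV[R]_n | forall i,
    y ord0 i \in `[(x - const_mx r) ord0 i, (x + const_mx r) ord0 i]]).
  rewrite lebesgue_rV_box; last by move=> i; rewrite !mxE; lra.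
  congr (_%:E); rewrite (eq_bigr (fun=> r *+ 2)).
    by rewrite prodr_const card_ord.
  by move=> i _; rewrite !mxE; lra.
apply/seteqP; split => y /= H i; have := H i; rewrite !mxE in_itv/=.
  by rewrite ler_distlC.
by rewrite ler_distlC.
Qed.

Lemma measurable_cube M : measurable (cube M).
Proof.
rewrite (_ : cube M = \bigcap_(i in [set: 'I_n])
   (fun y : 'rV[R]_n => y ord0 i) @^-1` `[- M, M]); last first.
  apply/seteqP; split => y /=.
    by move=> H i _; have := H i; rewrite /= in_itv/= ler_norml.
  by move=> H i; have := H i I; rewrite /= in_itv/= ler_norml.
apply: fin_bigcap_measurable => // i _; rewrite -[X in measurable X]setTI.
by apply: measurable_rV_entry => //; exact: measurable_itv.
Qed.

Lemma lebesgue_rV_bounded U : measurable U -> bounded_set U -> (mu U < +oo)%E.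
Proof.
move=> mU /bounded_sub_cube[M M0 UM].
apply: (@le_lt_trans _ _ (mu (cube M))).
  by apply: le_measure; rewrite ?inE//; exact: measurable_cube.
have -> : cube M = [set y | forall i, `|(0 : 'rV[R]_n) ord0 i - y ord0 i| <= M].
  by apply/seteqP; split => y H i; have := H i; rewrite mxE sub0r normrN.
by rewrite lebesgue_rV_cball ?ltW// ltry.
Qed.

End borel_rV.

(** * Smooth functions are Lipschitz on cubes *)

Section lipschitz.
Context (R : realType) (n : nat).
Implicit Types (f : 'rV[R]_n -> R) (x y z : 'rV[R]_n).

Lemma compact_cube (M : R) : compact (@cube R n M).
Proof.
rewrite (_ : cube M = [set v : 'rV[R]_n | forall i, `[- M, M]%classic (v ord0 i)]).
  apply: (@rV_compact _ _ (fun=> `[- M, M]%classic)) => _; exact: segment_compact.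
by apply/seteqP; split => x H i; have := H i; rewrite /= in_itv/= ler_norml.
Qed.

Lemma continuous_bounded_cube f (M : R) : continuous f ->
  exists2 B, 0 <= B & forall x, cube M x -> `|f x| <= B.
Proof.
move=> cf; have : bounded_set (f @` cube M).
  apply/compact_bounded/continuous_compact; last exact: compact_cube.
  exact/continuous_subspaceT.
move=> [B [_ HB]]; exists (`|B| + 1); first by rewrite addr_ge0.
move=> x Mx; apply: (HB (`|B| + 1)); last by exists x.
by rewrite (le_lt_trans (ler_norm _))// ltrDl.
Qed.

Lemma is_derive_line f z v (t : R) : derivable f (t *: v + z) v ->
  is_derive t 1 (fun t => f (t *: v + z)) ('D_v f (t *: v + z)).
Proof.
move=> df.
have H : (fun h : R => h^-1 *: (((fun t : R => f (t *: v + z)) \o shift t) (h *: 1) -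
    f (t *: v + z))) = (fun h => h^-1 *: ((f \o shift (t *: v + z)) (h *: v) - f (t *: v + z))).
  by apply/funext => h /=; rewrite [h *: 1]mulr1 scalerDl addrA.
by split; rewrite /derivable /derive H.
Qed.

(** One-dimensional mean value theorem along a coordinate direction; the whole
    segment stays in the cube, where the partial derivative is bounded. *)
Lemma line_increment f (i : 'I_n) (M B : R) z (t : R) : 
  (forall x, derivable f x (delta_mx ord0 i)) ->
  (forall x, cube M x -> `|'D_(delta_mx ord0 i) f x| <= B) ->
  cube M z -> cube M (t *: delta_mx ord0 i + z) ->
  `|f (t *: delta_mx ord0 i + z) - f z| <= B * `|t|.
Proof.
move=> df fB Mz Mtz; set v := delta_mx ord0 i in df fB Mtz *.
(* Points of the segment: c has the sign of t and is not larger than t. *)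
have Mcz c : `|c| <= `|t| -> 0 <= c * t -> cube M (c *: v + z).
  move=> ct ct0 j; have := Mtz j; have := Mz j; rewrite !mxE eqxx/=.
  case: (j == i); rewrite ?mulr0 ?add0r// !mulr1 !ler_norml.
  move: ct ct0; case: (ger0P t) => t0; case: (ger0P c) => c0 ct ct0.
  - lra.
  - have : c * t < 0 by rewrite nmulr_rlt0//; lra.
    lra.
  - have : c <= 0 by rewrite -(nmulr_lge0 c t0).
    lra.
  - lra.
pose phi (t : R) := f (t *: v + z).
have dphi (c : R) : is_derive c 1 phi ('D_v f (c *: v + z)).
  exact: is_derive_line.
have cphi a b : {within `[a, b], continuous phi}.
  by apply: derivable_within_continuous => c _; have [] := dphi c.
have -> : f z = phi 0 by rewrite /phi scale0r add0r.
rewrite -/(phi t).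
have [t0|t0] := lerP 0 t.
  have [c] := MVT_segment t0 (fun c _ => dphi c) (cphi _ _).
  rewrite in_itv/= => /andP[c0 ct] ->; rewrite subr0 normrM ler_wpM2r//.
  by apply/fB/Mcz; [rewrite !ger0_norm|rewrite mulr_ge0].
have [c] := MVT_segment (ltW t0) (fun c _ => dphi c) (cphi _ _).
rewrite in_itv/= => /andP[c0 ct] E; rewrite -normrN opprB E sub0r normrM normrN.
rewrite ler_wpM2r//; apply/fB/Mcz; last by rewrite mulr_le0// ltW.
by rewrite !ler0_norm ?lerN2 ?(ltW t0).
Qed.

(** The points x and y are joined by a path that replaces the coordinates of y
    by those of x one at a time; it remains in the cube. *)
Lemma Ck1_lipschitz_cube f (M : R) : Ck 1 f -> exists2 L, 0 <= L &
  forall x y, cube M x -> cube M y -> `|f x - f y| <= L * enorm (x - y).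
Proof.
move=> [_ df].
have HB i : exists B, 0 <= B /\ forall x, cube M x -> `|'D_(delta_mx ord0 i) f x| <= B.
  by have [_ [/(continuous_bounded_cube M)[B B0 HB] _]] := df i; exists B.
have [B HBB] := choice HB.
exists (\sum_(i < n) B i) => [|x y Mx My].
  by apply: sumr_ge0 => i _; have [] := HBB i.
pose w (k : nat) : 'rV[R]_n := \row_j (if (j < k)%N then x ord0 j else y ord0 j).
have w0 : w 0%N = y by apply/rowP => j; rewrite mxE.
have wn : w n = x by apply/rowP => j; rewrite mxE ltn_ord.
have Mw k : cube M (w k) by move=> j; rewrite mxE; case: ifP.
have -> : f x - f y = \sum_(i < n) (f (w i.+1) - f (w i)).
  by rewrite -{1}w0 -{1}wn -(big_mkord xpredT (fun i => f (w i.+1) - f (w i))) telescope_sumr.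
rewrite (le_trans (ler_norm_sum _ _ _))// mulr_suml; apply: ler_sum => i _.
have E : w i.+1 = (x ord0 i - y ord0 i) *: delta_mx ord0 i + w i.
  apply/rowP => j; rewrite !mxE eqxx ltnS leq_eqVlt/=.
  have [->|ij] := eqVneq j i; first by rewrite eqxx ltnn mulr1 subrK.
  by rewrite (_ : (_ == _ :> nat) = false) ?mulr0 ?add0r//; apply/negbTE.
have [Bi0 HBi] := HBB i.
rewrite E; apply: (le_trans (@line_increment f i M (B i) (w i) _ _ HBi _ _)) => //.
- by have [] := df i.
- by rewrite -E.
- by rewrite ler_wpM2l// (le_trans _ (entry_le_enorm _ i))// !mxE.
Qed.

End lipschitz.

(** * Finiteness of the Gagliardo energy of Lipschitz functions *)

Section gagliardo_lipschitz.
Context (R : realType) (n : nat).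
Local Notation mu := (lebesgue_rV R n).
Local Notation mu2 := (mu \x mu)%E.

Lemma nneseries_geometric_lty (a z : R) : 0 <= a -> 0 <= z < 1 ->
  (\sum_(0 <= k <oo) (a * z ^+ k)%:E < +oo)%E.
Proof.
move=> a0 /andP[z0 z1].
apply: (@le_lt_trans _ _ (a / (1 - z))%:E); last by rewrite ltry.
apply: lime_le.
  by apply: is_cvg_nneseries => k _ _; rewrite lee_fin mulr_ge0// exprn_ge0.
apply: nearW => k; rewrite sumEFin lee_fin.
have := geometric_seriesE a (negbT (lt_eqF z1)) => /(congr1 (fun u => u k)).
rewrite /series/= => ->; rewrite ler_wpM2r ?invr_ge0 ?subr_ge0 ?(ltW z1)//.
by rewrite ler_piMr// gerBl exprn_ge0.
Qed.

(** Each section of this set lies in a cube of side 2 r. *)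
Lemma lebesgue_rV_near_diagonal (U : set 'rV[R]_n) (r : R) : measurable U -> 0 <= r ->
  (mu2 [set z | [/\ U z.1, U z.2 & (enorm (z.1 - z.2) <= r)%R]] <=
   mu U * ((r *+ 2) ^+ n)%:E)%E.
Proof.
move=> mU r0; rewrite /product_measure1/=.
have muUE : (\int[mu]_(x in U) (((r *+ 2) ^+ n)%:E) = mu U * ((r *+ 2) ^+ n)%:E)%E.
  by rewrite integral_cst// muleC.
rewrite -muUE.
rewrite [leRHS]integral_mkcond; apply: ge0_ae_le_integral => //.
  by move=> x _; rewrite patchE; case: ifPn => // _; rewrite lee_fin exprn_ge0// mulrn_wge0.
apply: aeW => x _; rewrite patchE; case: ifPn => xU; last first.
  rewrite (_ : xsection _ _ = set0) ?measure0//; apply/seteqP; split => // y.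
  by rewrite /xsection/= inE => -[/= /mem_set]; rewrite (negbTE xU).
rewrite -(@lebesgue_rV_cball R n x)//; apply: le_measure; rewrite ?inE.
- apply: measurable_xsection.
  rewrite (_ : [set _ | _] = (U `*` U) `&` (fun z => enorm (z.1 - z.2)) @^-1` `]-oo, r]).
    apply: measurableI; first exact: measurableX.
    by rewrite -[X in measurable X]setTI; apply: measurable_enormB.
  by apply/seteqP; split => z /=; rewrite in_itv/=; [move=> []|move=> [[]]].
- rewrite (_ : [set _ | _] = \bigcap_(i in [set: 'I_n])
     (fun y : 'rV[R]_n => y ord0 i) @^-1` `[x ord0 i - r, x ord0 i + r]); last first.
    apply/seteqP; split => y /=.
      by move=> H i _; have := H i; rewrite /= in_itv/= ler_distlC.
    by move=> H i; have := H i Logic.I; rewrite /= in_itv/= ler_distlC.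
  apply: fin_bigcap_measurable => // i _; rewrite -[X in measurable X]setTI.
  by apply: measurable_rV_entry => //; exact: measurable_itv.
- move=> y; rewrite /xsection/= inE => -[/= _ _ H] i.
  by apply: le_trans H; have := entry_le_enorm (x - y) i; rewrite !mxE.
Qed.

(** The integrand is at most L^p |x - y|^(p - n - sp), whose singularity is
    integrable because p - sp > 0. This is seen on dyadic shells: where |x - y|
    lies in (rho (k + 1), rho k], with rho k = D 2^-k, the integrand is at most
    c k, and the pairs at distance at most rho k have measure at most
    |U| (2 rho k)^n. The products of these bounds are a constant times
    (rho k)^(p - sp), a geometric sequence of ratio 2^-(p - sp) < 1. *)
Lemma gagliardo_lipschitz_lty (s p : R) (U : set 'rV[R]_n) (f : 'rV[R]_n -> R) (L : R) :
  0 < s < 1 -> 0 < p -> measurable U -> bounded_set U ->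
  0 <= L -> (forall x y, U x -> U y -> `|f x - f y| <= L * enorm (x - y)) ->
  (\int[mu2]_(z in U `*` U)
     (`|f z.1 - f z.2| `^ p / enorm (z.1 - z.2) `^ (n%:R + s * p))%:E < +oo)%E.
Proof.
move=> /andP[s0 s1] p0 mU bU L0 fL.
have [M M0 UM] := bounded_sub_cube bU.
have muU := lebesgue_rV_bounded mU bU.
pose D := Num.sqrt (n%:R * (M *+ 2) ^+ 2) + 1.
have D0 : 0 < D by rewrite ltr_wpDl// sqrtr_ge0.
have UD x y : U x -> U y -> enorm (x - y) <= D.
  move=> Ux Uy; apply: (@le_trans _ _ (Num.sqrt (n%:R * (M *+ 2) ^+ 2))); last by rewrite lerDl.
  apply: enorm_le_entries => i; rewrite !mxE (le_trans (ler_normB _ _))// mulr2n.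
  by rewrite lerD//; apply: UM.
set a := n%:R + s * p.
have a0 : 0 < a by rewrite ltr_wpDl// mulr_gt0.
pose rho (k : nat) : R := D * 2^-1 ^+ k.
have rho0 k : 0 < rho k by rewrite mulr_gt0// exprn_gt0// invr_gt0.
have rhoS k : rho k = rho k.+1 * 2.
  by rewrite /rho exprSr mulrA divfK// pnatr_eq0.
pose A k := [set z : 'rV[R]_n * 'rV[R]_n | [/\ U z.1, U z.2 & enorm (z.1 - z.2) <= rho k]].
have mA k : measurable (A k).
  rewrite (_ : A k = (U `*` U) `&` (fun z => enorm (z.1 - z.2)) @^-1` `]-oo, rho k]).
    apply: measurableI; first exact: measurableX.
    by rewrite -[X in measurable X]setTI; apply: measurable_enormB.
  by apply/seteqP; split => z /=; rewrite in_itv/=; [move=> []|move=> [[]]].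
pose c k := (L * rho k) `^ p / rho k.+1 `^ a.
have c0 k : 0 <= c k by rewrite divr_ge0 ?powR_ge0.
apply: (@le_lt_trans _ _ (\int[mu2]_z (\sum_(k <oo) (c k * \1_(A k) z)%:E))%E).
  rewrite integral_mkcond; apply: ge0_ae_le_integral.
  - move=> z _; rewrite patchE; case: ifPn => // _.
    by rewrite lee_fin divr_ge0 ?powR_ge0.
  - by move=> z _; apply: nneseries_ge0 => k _ _; rewrite lee_fin mulr_ge0.
  apply: aeW => -[x y] _; rewrite patchE.
  have S0 : (0 <= \sum_(k <oo) (c k * \1_(A k) (x, y))%:E)%E.
    by apply: nneseries_ge0 => k _ _; rewrite lee_fin mulr_ge0.
  case: ifPn => // /set_mem[/= Ux Uy].
  (* At distance 0 the Lipschitz bound makes the numerator vanish. *)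
  have [e0|e0] := eqVneq (enorm (x - y)) 0.
    have := fL _ _ Ux Uy; rewrite e0 mulr0 normr_le0 => /eqP fxy; rewrite /= fxy.
    by rewrite normr0 (powR0 (lt0r_neq0 p0)) mul0r.
  have {}e0 : 0 < enorm (x - y) by rewrite lt_def e0 enorm_ge0.
  have ex : exists k, rho k < enorm (x - y).
    have q1 : `|2^-1 : R| < 1 by rewrite ger0_norm ?invr_ge0// invf_lt1// ltr1n.
    have /cvgrPdist_lt/(_ _ e0)[k _ Hk] := @cvg_geometric R D _ q1.
    exists k; have := Hk k (leqnn k); rewrite /= sub0r normrN ger0_norm//.
    exact: ltW (rho0 k).
  have [[|k] rk km] := ex_minnP ex.
    by move: rk; rewrite /rho expr0 mulr1 ltNge UD.
  have ek : enorm (x - y) <= rho k.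
    by rewrite leNgt; apply/negP => /km; rewrite ltnn.
  have Ak : A k (x, y) by split.
  apply: (@le_trans _ _ (\sum_(0 <= j < k.+1) (c j * \1_(A j) (x, y))%:E)%E); last first.
    by apply: nneseries_lim_ge => j _ _; rewrite lee_fin mulr_ge0.
  rewrite sumEFin lee_fin big_nat_recr//= indicE mem_set// mulr1.
  apply: (@le_trans _ _ (c k)); last first.
    by rewrite lerDr sumr_ge0// => j _; rewrite mulr_ge0.
  rewrite /c; apply: ler_pM; rewrite ?powR_ge0 ?invr_ge0 ?powR_ge0//.
    apply: ge0_ler_powR; rewrite ?nnegrE ?(mulr_ge0 L0 (ltW (rho0 k))) ?(ltW p0)//.
    by apply: (le_trans (fL _ _ Ux Uy)); rewrite ler_wpM2l.
  rewrite lef_pV2 ?posrE ?powR_gt0//.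
  by apply: ge0_ler_powR; rewrite ?nnegrE ?ltW.
rewrite integral_nneseries//; last 2 first.
- by move=> k; apply/measurable_EFinP/measurable_funM => //; exact: measurable_indic.
- by move=> k z _; rewrite lee_fin mulr_ge0.
pose q : R := 2^-1 `^ (p - s * p).
pose m := fine (mu U).
have mE : mu U = m%:E by rewrite fineK// ge0_fin_numE.
have m0 : 0 <= m by rewrite fine_ge0.
pose C := L `^ p * 2 `^ a * m * 2 ^+ n * D `^ (p - s * p).
apply: (@le_lt_trans _ _ (\sum_(k <oo) (C * q ^+ k)%:E)%E); last first.
  apply: nneseries_geometric_lty.
    by rewrite /C !mulr_ge0 ?powR_ge0 ?exprn_ge0.
  rewrite powR_ge0/=; have <- : 1 `^ (p - s * p) = 1 :> R by rewrite powR1.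
  apply: gt0_ltr_powR; rewrite ?nnegrE ?invr_ge0// ?invf_lt1 ?ltr1n//.
  by rewrite subr_gt0 gtr_pMl.
apply: lee_nneseries => [k _ _|k _].
  by apply: integral_ge0 => z _; rewrite lee_fin mulr_ge0.
under eq_integral do rewrite EFinM.
rewrite ge0_integralZl_EFin//; last first.
  by apply/measurable_EFinP; exact: measurable_indic.
rewrite integral_indic// setIT.
apply: (@le_trans _ _ ((c k)%:E * (mu U * ((rho k *+ 2) ^+ n)%:E))%E).
  by rewrite lee_wpmul2l ?lee_fin//; apply: lebesgue_rV_near_diagonal => //; exact: ltW.
rewrite mE -!EFinM lee_fin le_eqVlt; apply/orP; left; apply/eqP.
have rE : rho k `^ (p - s * p) = D `^ (p - s * p) * q ^+ k.
  rewrite /rho powRM ?(ltW D0) ?exprn_ge0 ?invr_ge0//.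
  have q0 : (0 : R) <= 2^-1 by rewrite invr_ge0.
  by rewrite -(powR_mulrn k q0) -(powR_mulrn k (powR_ge0 _ _ : 0 <= q)) powRAC.
have -> : C * q ^+ k = L `^ p * 2 `^ a * m * 2 ^+ n * rho k `^ (p - s * p).
  by rewrite rE /C; ring.
have rpE : rho k `^ p = rho k `^ (p - s * p) * rho k `^ (s * p).
  by rewrite -powRD ?subrK// (gt_eqF (rho0 k)) implybT.
have raE : rho k `^ a = rho k ^+ n * rho k `^ (s * p).
  by rewrite /a powRD ?(gt_eqF (rho0 k)) ?implybT// powR_mulrn// ltW.
have rSE : rho k `^ a = rho k.+1 `^ a * 2 `^ a by rewrite rhoS powRM// ltW.
rewrite /c (powRM _ L0 (ltW (rho0 k))).
rewrite rpE -[rho k *+ 2]mulr_natr exprMn.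
have -> : rho k.+1 `^ a = rho k ^+ n * rho k `^ (s * p) / 2 `^ a.
  by rewrite -raE rSE mulfK// gt_eqF// powR_gt0.
have h1 : rho k ^+ n != 0 by rewrite gt_eqF// exprn_gt0.
have h2 : rho k `^ (s * p) != 0 by rewrite gt_eqF// powR_gt0.
have h3 : (2 : R) `^ a != 0 by rewrite gt_eqF// powR_gt0.
field.
by rewrite h1 h2 h3.
Qed.

End gagliardo_lipschitz.

(** * Fractional Sobolev and tail spaces *)

Section lower_integral_bounds.
Local Open Scope ereal_scope.
Context d (T : measurableType d) (R : realType) (mu : {measure set T -> \bar R}).
Implicit Types (D : set T).

Lemma ge0_subset_lower_integral (A B : set T) (f : T -> \bar R) :
  A `<=` B -> (forall x, B x -> 0 <= f x) ->
  \int[mu]_(x in A) f x <= \int[mu]_(x in B) f x.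
Proof.
move=> AB f0; rewrite integral_mkcond [leRHS]integral_mkcond.
have r0 D x : D `<=` B -> 0 <= (f \_ D) x.
  by move=> DB; rewrite patchE; case: ifPn => // /set_mem/DB/f0.
apply: ge0_ae_le_integral; try by move=> x _; exact: r0.
apply: nearW => x _; rewrite [leLHS]patchE; case: ifPn => [/set_mem Ax|_]; last exact: r0.
by rewrite patchE mem_set//; exact: AB.
Qed.

(** Lower integrals are not subadditive in general; here f and g have measurable
    versions f' and g', for which the integral is additive. *)
Lemma lower_integral_lincomb_lty D (f f' g g' h : T -> R) (a b : R) :
  measurable D -> measurable_fun setT f' -> measurable_fun setT g' ->
  {ae mu, forall x, D x -> f x = f' x} -> {ae mu, forall x, D x -> g x = g' x} ->
  (forall x, 0 <= f' x)%R -> (forall x, 0 <= g' x)%R -> (forall x, 0 <= h x)%R ->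
  (0 <= a)%R -> (0 <= b)%R ->
  {ae mu, forall x, D x -> (h x <= a * f x + b * g x)%R} ->
  \int[mu]_(x in D) (f x)%:E < +oo -> \int[mu]_(x in D) (g x)%:E < +oo ->
  \int[mu]_(x in D) (h x)%:E < +oo.
Proof.
move=> mD mf' mg' ff' gg' f0 g0 h0 a0 b0 hfg.
rewrite (ae_eq_lower_integral (f := EFin \o f) (g := EFin \o f')); last first.
  by apply: filterS ff' => x + Dx => /= ->.
rewrite (ae_eq_lower_integral (f := EFin \o g) (g := EFin \o g')) => [intf intg|]; last first.
  by apply: filterS gg' => x + Dx => /= ->.
apply: (@le_lt_trans _ _ (\int[mu]_(x in D) (a%:E * (f' x)%:E + b%:E * (g' x)%:E))).
  apply: ge0_ae_le_integral; [by move=> x _; rewrite lee_fin|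
      by move=> x _; rewrite adde_ge0// mule_ge0// lee_fin|].
  apply: filterS3 ff' gg' hfg => x fE gE hE Dx.
  by rewrite -!EFinM -EFinD lee_fin -fE// -gE// hE.
have mEf' : measurable_fun D (EFin \o f').
  by apply/measurable_EFinP; exact: measurable_funTS.
have mEg' : measurable_fun D (EFin \o g').
  by apply/measurable_EFinP; exact: measurable_funTS.
rewrite ge0_integralD//; last 4 first.
- by move=> x _; rewrite mule_ge0// lee_fin.
- by apply/measurable_EFinP; apply: measurable_funM => //; exact: measurable_funTS.
- by move=> x _; rewrite mule_ge0// lee_fin.
- by apply/measurable_EFinP; apply: measurable_funM => //; exact: measurable_funTS.
rewrite !ge0_integralZl_EFin//; try by move=> x _; rewrite lee_fin.
apply: lte_add_pinfty; apply: lte_mul_pinfty => //; rewrite ?lee_fin//.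
Qed.

End lower_integral_bounds.

Section powR_bounds.
Context (R : realType).
Implicit Types (a b p : R).

Lemma powR_normD_le a b p : 0 <= p ->
  `|a + b| `^ p <= 2 `^ p * `|a| `^ p + 2 `^ p * `|b| `^ p.
Proof.
move=> p0; wlog ab : a b / `|b| <= `|a|.
  move=> H; have [|/ltW] := leP `|b| `|a|; first exact: H.
  by move=> /H; rewrite addrC [leRHS]addrC.
apply: (@le_trans _ _ (2 `^ p * `|a| `^ p)); last by rewrite lerDl mulr_ge0// powR_ge0.
rewrite -powRM//; apply: ge0_ler_powR; rewrite ?nnegrE ?mulr_ge0//.
by rewrite mulr_natl mulr2n (le_trans (ler_normD _ _))// lerD2l.
Qed.

Lemma powR_le1D a p : 0 <= a -> 1 < p -> a `^ (p - 1) <= 1 + a `^ p.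
Proof.
move=> a0 p1; have p10 : 0 <= p - 1 by rewrite subr_ge0 ltW.
have [a1|/ltW a1] := leP a 1.
  apply: (@le_trans _ _ 1); last by rewrite lerDl powR_ge0.
  by have := @ge0_ler_powR _ _ p10 a 1; rewrite powR1; apply; rewrite ?nnegrE.
by apply: (@le_trans _ _ (a `^ p)); [apply: ler_powR => //; rewrite gerBl|rewrite lerDr].
Qed.

End powR_bounds.

Section fractional_sobolev.
Context (R : realType) (n : nat) (s p : R).
Local Notation mu := (lebesgue_rV R n).
Local Notation mu2 := (mu \x mu)%E.
Implicit Types (U V C : set 'rV[R]_n) (f g u v w eta : 'rV[R]_n -> R).
Hypothesis p0 : 0 < p.

Definition Lp_energy U v : \bar R := (\int[mu]_(x in U) (`|v x| `^ p)%:E)%E.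

Definition gagliardo_energy U v : \bar R :=
  (\int[mu2]_(z in U `*` U)
    (`|v z.1 - v z.2| `^ p / enorm (z.1 - z.2) `^ (n%:R + s * p))%:E)%E.

Lemma WspP U v : Wsp s p U v <->
  [/\ completed_measurable_fun mu U v, (Lp_energy U v < +oo)%E
    & (gagliardo_energy U v < +oo)%E].
Proof.
split=> [[mv]|[mv h1 h2]].
  rewrite /Wsp_norm => H.
  have pV : p^-1 != 0 by rewrite invr_eq0 gt_eqF.
  split=> //; apply: (lty_poweRy pV); apply: le_lt_trans H.
    by rewrite leeDl// poweR_ge0.
  by rewrite leeDr// poweR_ge0.
by split=> //; apply: lte_add_pinfty; apply: poweR_lty.
Qed.

Lemma gagliardo_integrand_ge0 (v : 'rV[R]_n -> R) (z : 'rV[R]_n * 'rV[R]_n) :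
  0 <= `|v z.1 - v z.2| `^ p / enorm (z.1 - z.2) `^ (n%:R + s * p).
Proof. by rewrite divr_ge0// powR_ge0. Qed.

Lemma measurable_gagliardo v : measurable_fun setT v ->
  measurable_fun setT (fun z : 'rV[R]_n * 'rV[R]_n =>
    `|v z.1 - v z.2| `^ p / enorm (z.1 - z.2) `^ (n%:R + s * p)).
Proof.
move=> mv; apply: measurable_funM.
  apply: (measurableT_comp (measurable_powR _)).
  apply: measurableT_comp => //; apply: measurable_funB.
    exact: measurableT_comp.
  exact: measurableT_comp.
rewrite (_ : (fun _ => _) = fun z : 'rV[R]_n * 'rV[R]_n =>
   enorm (z.1 - z.2) `^ (- (n%:R + s * p))); last by apply/funext => z; rewrite powRN.
by apply: (measurableT_comp (measurable_powR _)); exact: measurable_enormB.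
Qed.

Lemma ae_pair (D : set 'rV[R]_n) (P : 'rV[R]_n -> Prop) :
  {ae mu, forall x, D x -> P x} ->
  {ae mu2, forall z, (D `*` D) z -> P z.1 /\ P z.2}.
Proof.
move=> H; apply: filterS2 (ae_fst mu H) (ae_snd mu H) => z H1 H2 [D1 D2].
by split; [exact: H1|exact: H2].
Qed.

(** Both parts of the norm are controlled by the pointwise inequality
    |a + b|^p <= 2^p (|a|^p + |b|^p). *)
Lemma Wsp_add_scale U v w (c : R) : measurable U ->
  Wsp s p U v -> Wsp s p U w -> Wsp s p U (fun x => v x + c * w x).
Proof.
move=> mU /WspP[mv v1 v2] /WspP[mw w1 w2]; apply/WspP.
have [vb mvb vE] := completed_measurable_fun_borel mU mv.
have [wb mwb wE] := completed_measurable_fun_borel mU mw.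
split.
- apply: (borel_completed_measurable_fun (g := fun x => vb x + c * wb x)) => //.
    by apply: measurable_funD => //; exact: measurable_funM.
  by apply: filterS2 vE wE => x vE wE Ux; rewrite vE// wE.
- apply: (lower_integral_lincomb_lty (f' := fun x => `|vb x| `^ p)
    (g' := fun x => `|wb x| `^ p) (a := 2 `^ p) (b := 2 `^ p * `|c| `^ p) _ _ _ _ _ _ _ _ _ _ _ v1 w1).
  + by [].
  + by apply: (measurableT_comp (measurable_powR _)); exact: measurableT_comp.
  + by apply: (measurableT_comp (measurable_powR _)); exact: measurableT_comp.
  + by apply: filterS vE => x + Ux => ->.
  + by apply: filterS wE => x + Ux => ->.
  + by move=> x; rewrite powR_ge0.
  + by move=> x; rewrite powR_ge0.
  + by move=> x; rewrite powR_ge0.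
  + by rewrite powR_ge0.
  + by rewrite mulr_ge0// powR_ge0.
  + apply: nearW => x _; rewrite -mulrA -(powRM _ (normr_ge0 c))// -normrM.
    by apply: powR_normD_le; exact: ltW.
- apply: (lower_integral_lincomb_lty
    (f' := fun z => `|vb z.1 - vb z.2| `^ p / enorm (z.1 - z.2) `^ (n%:R + s * p))
    (g' := fun z => `|wb z.1 - wb z.2| `^ p / enorm (z.1 - z.2) `^ (n%:R + s * p))
    (a := 2 `^ p) (b := 2 `^ p * `|c| `^ p) _ _ _ _ _ _ _ _ _ _ _ v2 w2).
  + exact: measurableX.
  + exact: measurable_gagliardo.
  + exact: measurable_gagliardo.
  + by apply: filterS (ae_pair vE) => z + Uz => /(_ Uz)[-> ->].
  + by apply: filterS (ae_pair wE) => z + Uz => /(_ Uz)[-> ->].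
  + exact: gagliardo_integrand_ge0.
  + exact: gagliardo_integrand_ge0.
  + exact: (gagliardo_integrand_ge0 (fun x => v x + c * w x)).
  + by rewrite powR_ge0.
  + by rewrite mulr_ge0// powR_ge0.
  + apply: nearW => z _; rewrite !mulrA -mulrDl ler_wpM2r ?invr_ge0 ?powR_ge0//.
    rewrite -mulrA -(powRM _ (normr_ge0 c))// -normrM.
    rewrite (_ : v z.1 + c * w z.1 - _ = (v z.1 - v z.2) + c * (w z.1 - w z.2)); last by ring.
    by apply: powR_normD_le; exact: ltW.
Qed.

Lemma WspN U v : measurable U -> Wsp s p U v -> Wsp s p U (fun x => - v x).
Proof.
move=> mU Wv; have := Wsp_add_scale (- 2) mU Wv Wv.
by congr (Wsp _ _ _ _); apply/funext => x; ring.
Qed.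

Lemma Wsp_subset U V v : measurable U -> measurable V -> V `<=` U ->
  Wsp s p U v -> Wsp s p V v.
Proof.
move=> mU mV VU /WspP[mv v1 v2]; apply/WspP; split.
- have [vb mvb vE] := completed_measurable_fun_borel mU mv.
  by apply: (borel_completed_measurable_fun mV mvb); apply: filterS vE => x + /VU.
- apply: le_lt_trans v1; apply: (ge0_subset_lower_integral _ VU) => x _.
  by rewrite lee_fin powR_ge0.
- apply: le_lt_trans v2; apply: ge0_subset_lower_integral => [z [z1 z2]|z _].
    by split; exact: VU.
  by rewrite lee_fin gagliardo_integrand_ge0.
Qed.

Lemma Ck1_Wsp U eta : 0 < s < 1 -> measurable U -> bounded_set U -> Ck 1 eta ->
  Wsp s p U eta.
Proof.
move=> s01 mU bU Ceta; have ceta : continuous eta by have [] := Ceta.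
have meta := continuous_rV_measurable_fun ceta.
have [M M0 UM] := bounded_sub_cube bU.
apply/WspP; split.
- by apply: (borel_completed_measurable_fun mU meta); apply: nearW.
- have [B B0 HB] := continuous_bounded_cube M ceta.
  apply: (@le_lt_trans _ _ (\int[mu]_(x in U) (B `^ p)%:E)%E).
    apply: ge0_ae_le_integral => [x _|x _|]; rewrite ?lee_fin ?powR_ge0//.
    apply: nearW => x Ux; rewrite lee_fin.
    by apply: ge0_ler_powR; rewrite ?nnegrE// ?(ltW p0)//; exact/HB/UM.
  rewrite integral_cst//; apply: lte_mul_pinfty; rewrite ?lee_fin ?powR_ge0//.
  exact: lebesgue_rV_bounded.
- have [L L0 HL] := Ck1_lipschitz_cube M Ceta.
  apply: (gagliardo_lipschitz_lty s01 p0 mU bU L0) => x y Ux Uy.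
  by apply: HL; exact: UM.
Qed.

End fractional_sobolev.

Section tail_space.
Context (R : realType) (n : nat) (s p : R).
Local Notation mu := (lebesgue_rV R n).
Implicit Types (U V C : set 'rV[R]_n) (f g u v w : 'rV[R]_n -> R).
Hypothesis s0 : 0 < s.
Hypothesis p1 : 1 < p.

Lemma tail_spaceN u : tail_space s p u -> tail_space s p (fun x => - u x).
Proof.
move=> [mu' uC uT]; split.
- have [ub mub uE] := completed_measurable_fun_borel measurableT mu'.
  apply: (borel_completed_measurable_fun (g := \- ub)) => //.
    exact: measurable_funN.
  by apply: filterS uE => x + _ => ->.
- by move=> C /uC; under eq_integral do rewrite -normrN.
- by move: uT; under eq_integral do rewrite -normrN.
Qed.

Lemma tail_weight_le1 (x : 'rV[R]_n) : (1 + enorm x) `^ (- n%:R - s * p) <= 1.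
Proof.
rewrite -[leRHS](powRr0 (1 + enorm x)); apply: ler_powR; first by rewrite lerDl enorm_ge0.
by rewrite -opprD oppr_le0 addr_ge0// mulr_ge0 ?ltW// (lt_trans _ p1).
Qed.

Lemma measurable_tail_weight :
  measurable_fun setT (fun x : 'rV[R]_n => (1 + enorm x) `^ (- n%:R - s * p)).
Proof.
apply: (measurableT_comp (measurable_powR _)); apply: measurable_funD => //.
by apply: continuous_rV_measurable_fun; exact: enorm_continuous.
Qed.

(** Measurability on U comes from the Sobolev function, measurability outside U
    from the boundary values. *)
Lemma ae_eq_compl_completed_measurable U u g : measurable U ->
  completed_measurable_fun mu U u -> completed_measurable_fun mu setT g ->
  {ae mu, forall x, ~ U x -> u x = g x} -> completed_measurable_fun mu setT u.
Proof.
move=> mU mu' mg ug.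
have [ub mub uE] := completed_measurable_fun_borel mU mu'.
have [gb mgb gE] := completed_measurable_fun_borel measurableT mg.
apply: (borel_completed_measurable_fun (g := fun x => ub x * \1_U x + gb x * \1_(~` U) x)) => //.
  apply: measurable_funD; apply: measurable_funM => //; apply: measurable_indic => //.
  exact: measurableC.
apply: filterS3 uE gE ug => x uE gE ug _; rewrite !indicE in_setC.
case: (boolP (x \in U)) => [/set_mem/uE->|/negP xU]; rewrite /= ?mulr1 ?mulr0 ?addr0//.
by rewrite add0r ug ?gE// => /mem_set.
Qed.

(** On the bounded set U the power p - 1 is dominated by 1 + |u|^p, which is
    integrable, and the tail weight is at most 1; outside U the integrand is that
    of g. *)
Lemma tail_space_patch U u g : measurable U -> bounded_set U -> Wsp s p U u ->
  tail_space s p g -> {ae mu, forall x, ~ U x -> u x = g x} -> tail_space s p u.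
Proof.
move=> mU bU Wu [mg gC gT] ug.
have p0 : 0 < p by rewrite (lt_trans _ p1).
have [mu' uLp _] := (WspP s p0 U u).1 Wu.
have muT := ae_eq_compl_completed_measurable mU mu' mg ug.
have [ub mub uE] := completed_measurable_fun_borel measurableT muT.
have [gb mgb gE] := completed_measurable_fun_borel measurableT mg.
have mpow r v : measurable_fun setT v -> measurable_fun setT (fun x => `|v x| `^ r).
  move=> mv; apply: (measurableT_comp (measurable_powR _)); exact: measurableT_comp.
have int1 : (\int[mu]_(x in U) (1 + `|u x| `^ p)%:E < +oo)%E.
  apply: (lower_integral_lincomb_lty (f := cst 1) (f' := cst 1) (g' := fun x => `|ub x| `^ p)
    (a := 1) (b := 1) _ _ _ _ _ _ _ _ _ _ _ _ uLp) => //.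
  - exact: mpow.
  - exact: nearW.
  - by apply: filterS uE => x + Ux => ->.
  - by apply: nearW => x _; rewrite !mul1r.
  - rewrite [X in (X < _)%E](_ : _ = mu U); first exact: lebesgue_rV_bounded.
    by rewrite -[RHS]mul1e -(integral_cst mu mU).
pose f x : R := \1_U x * (1 + `|u x| `^ p).
have intf D : (\int[mu]_(x in D) (f x)%:E < +oo)%E.
  apply: le_lt_trans int1.
  rewrite [leLHS]integral_mkcond [leRHS]integral_mkcond.
  apply: ge0_ae_le_integral => [x _|x _|].
  - by rewrite patchE; case: ifPn => // _; rewrite lee_fin mulr_ge0// addr_ge0// powR_ge0.
  - by rewrite patchE; case: ifPn => // _; rewrite lee_fin addr_ge0// powR_ge0.
  - apply: nearW => x _; rewrite !patchE /f indicE.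
    case: (x \in U); rewrite ?mul1r ?mul0r; case: ifPn => // _.
    by rewrite lee_fin addr_ge0// powR_ge0.
have H D (wt : 'rV[R]_n -> R) : measurable D -> measurable_fun setT wt ->
    (forall x, 0 <= wt x) -> (forall x, wt x <= 1) ->
    (\int[mu]_(x in D) (`|g x| `^ (p - 1) * wt x)%:E < +oo)%E ->
    (\int[mu]_(x in D) (`|u x| `^ (p - 1) * wt x)%:E < +oo)%E.
  move=> mD mw w0 w1 intg.
  apply: (lower_integral_lincomb_lty (f' := fun x => \1_U x * (1 + `|ub x| `^ p))
    (g' := fun x => `|gb x| `^ (p - 1) * wt x) (a := 1) (b := 1) _ _ _ _ _ _ _ _ _ _ _ (intf D) intg) => //.
  - by apply: measurable_funM; [exact: measurable_indic|apply: measurable_funD => //; exact: mpow].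
  - by apply: measurable_funM => //; exact: mpow.
  - by apply: filterS uE => x + _; rewrite /f => ->.
  - by apply: filterS gE => x + _ => ->.
  - by move=> x; rewrite mulr_ge0// addr_ge0// powR_ge0.
  - by move=> x; rewrite mulr_ge0// powR_ge0.
  - apply: filterS ug => x ug _; rewrite !mul1r /f indicE.
    case: (boolP (x \in U)) => [_|/negP xU].
      rewrite mul1r (@le_trans _ _ (`|u x| `^ (p - 1)))//.
        by rewrite ler_piMr// powR_ge0.
      apply: (@le_trans _ _ (1 + `|u x| `^ p)); first exact: powR_le1D.
      by rewrite lerDl mulr_ge0// powR_ge0.
    by rewrite mul0r add0r ug// => /mem_set.
split; first exact: muT.
- move=> C cC.
  have mC : measurable C.
    by apply: closed_rV_measurable; apply: compact_closed => //; exact: norm_hausdorff.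
  have E v : (\int[mu]_(x in C) (`|v x| `^ (p - 1) * cst 1 x)%:E =
    \int[mu]_(x in C) (`|v x| `^ (p - 1))%:E)%E by apply: eq_integral => x _; rewrite /= mulr1.
  by rewrite -E; apply: H => //; rewrite E; exact: gC.
- apply: H => //; [exact: measurable_tail_weight|move=> x; exact: powR_ge0|exact: tail_weight_le1].
Qed.

End tail_space.

(** * Signed integrals of symmetric functions on a product *)

Section signed_integrals.
Local Open Scope ereal_scope.

(** The positive and the negative part scale separately, and multiplication by a
    positive real is compatible with the convention +oo - +oo = -oo. *)
Lemma integralZl_gt0 d (T : measurableType d) (R : realType)
    (mu : {measure set T -> \bar R}) (D : set T) (f : T -> \bar R) (c : R) :
  (0 < c)%R -> measurable D -> measurable_fun D f ->
  \int[mu]_(x in D) (c%:E * f x) = c%:E * \int[mu]_(x in D) f x.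
Proof.
move=> c0 mD mf; have c0' := ltW c0.
rewrite integralE [in RHS]integralE.
have -> : \int[mu]_(x in D) (fun x => c%:E * f x)^\+ x =
    c%:E * \int[mu]_(x in D) f^\+ x.
  rewrite -ge0_integralZl_EFin//; last exact: measurable_funepos.
  by apply: eq_integral => x _; rewrite !funeposE maxe_pMr// ?mule0// lee_fin.
have -> : \int[mu]_(x in D) (fun x => c%:E * f x)^\- x =
    c%:E * \int[mu]_(x in D) f^\- x.
  rewrite -ge0_integralZl_EFin//; last exact: measurable_funeneg.
  by apply: eq_integral => x _; rewrite !funenegE maxe_pMr// ?mule0// ?muleN// lee_fin.
have P0 : 0 <= \int[mu]_(x in D) f^\+ x by apply: integral_ge0.
have N0 : 0 <= \int[mu]_(x in D) f^\- x by apply: integral_ge0.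
move: P0 N0; case: (\int[mu]_(x in D) f^\+ x) => [a| |] // _;
  case: (\int[mu]_(x in D) f^\- x) => [b| |] // _.
- by rewrite muleBr.
- by rewrite /= !gt0_muley// ?gt0_muleNy// lte_fin.
- by rewrite /= !gt0_muley// lte_fin.
- by rewrite /= !gt0_muley// ?gt0_muleNy// lte_fin.
Qed.

Section product.
Context d (T : measurableType d) (R : realType).
Variable m : {sigma_finite_measure set T -> \bar R}.

Let ge0_integral_swap_setX (A B : set T) (f : T * T -> \bar R) :
  measurable A -> measurable B -> measurable_fun setT f -> (forall z, 0 <= f z) ->
  {ae (m \x m), forall z, f (z.2, z.1) = f z} ->
  \int[m \x m]_(z in A `*` B) f z = \int[m \x m]_(z in B `*` A) f z.
Proof.
move=> mA mB mf f0 fs.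
have mAB : measurable (A `*` B) by exact: measurableX.
rewrite integral_mkcond integral_swap; last 2 first.
- by apply/measurable_restrict => //; exact: measurable_funTS.
- by move=> z; rewrite patchE; case: ifPn.
rewrite [RHS]integral_mkcond; apply: ae_eq_lower_integral.
apply: filterS fs => -[x y] /= fxy _; rewrite !patchE !in_setX/= andbC.
by case: ifPn.
Qed.

Lemma integral_swap_setX (A B : set T) (f : T * T -> \bar R) :
  measurable A -> measurable B -> measurable_fun setT f ->
  {ae (m \x m), forall z, f (z.2, z.1) = f z} ->
  \int[m \x m]_(z in A `*` B) f z = \int[m \x m]_(z in B `*` A) f z.
Proof.
move=> mA mB mf fs; rewrite integralE [RHS]integralE.
congr (_ - _); apply: ge0_integral_swap_setX => //.
- exact: measurable_funepos.
- by apply: filterS fs => z fz; rewrite !funeposE fz.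
- exact: measurable_funeneg.
- by apply: filterS fs => z fz; rewrite !funenegE fz.
Qed.

(** The square of the whole space splits into A' x A', A x ~A', its mirror image
    ~A' x A, and a part where f vanishes; the two mirror images contribute the
    same by symmetry. *)
Lemma integral_symmetric_split (A A' : set T) (f : T * T -> \bar R) :
  measurable A -> measurable A' -> A `<=` A' -> measurable_fun setT f ->
  {ae (m \x m), forall z, f (z.2, z.1) = f z} ->
  (forall z, ~ A z.1 -> ~ A z.2 -> f z = 0) ->
  \int[m \x m]_z f z = \int[m \x m]_(z in A' `*` A') f z +
    2%:E * \int[m \x m]_(z in A `*` ~` A') f z.
Proof.
move=> mA mA' AA' mf fs f0.
have mC : measurable (~` A') by exact: measurableC.
have m1 : measurable (A' `*` A') by exact: measurableX.
have m2 : measurable (A `*` ~` A') by exact: measurableX.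
have m3 : measurable (~` A' `*` A) by exact: measurableX.
have -> : \int[m \x m]_z f z =
    \int[m \x m]_(z in (A' `*` A') `|` ((A `*` ~` A') `|` (~` A' `*` A))) f z.
  rewrite [RHS]integral_mkcond; apply: eq_integral => -[x y] _; rewrite patchE.
  case: ifPn => // /negP; rewrite inE/= => H; apply: f0 => /= Az; apply: H.
    have [A'y|A'y] := pselect (A' y); first by left; split => //; exact: AA'.
    by right; left.
  have [A'x|A'x] := pselect (A' x); first by left; split => //; exact: AA'.
  by right; right.
have dis (X Y : set (T * T)) : (forall z, X z -> Y z -> False) -> [disjoint X & Y].
  by move=> XY; rewrite disj_set2E; apply/eqP/seteqP; split => // z [/XY].
rewrite integral_setU//; last 3 first.
- exact: measurableU.
- exact: measurable_funTS.
- by apply: dis => -[x y] [/= x1 y1] [[/= _]|[/=]].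
rewrite integral_setU//; last 2 first.
- exact: measurable_funTS.
- by apply: dis => -[x y] [/= x1 y1] [/= x2]; have := AA' _ x1.
rewrite (integral_swap_setX mC mA mf fs) -mule2n.
by rewrite mule_natl.
Qed.

End product.
End signed_integrals.

(** * Variations of the solution to the obstacle problem *)

Section weak_form.
Context (R : realType) (n : nat) (p : R).
Local Notation mu := (lebesgue_rV R n).
Local Notation mu2 := (mu \x mu)%E.
Implicit Types (u eta : 'rV[R]_n -> R) (K : 'rV[R]_n -> 'rV[R]_n -> R).

Lemma Lpow_sym (a b : R) : Lpow p b a = - Lpow p a b.
Proof. by rewrite /Lpow distrC -mulrN opprB. Qed.

Lemma LpowNN (a b : R) : Lpow p (- a) (- b) = - Lpow p a b.
Proof. by rewrite /Lpow -opprD normrN mulrN. Qed.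

Definition weak_integrand K u eta (z : 'rV[R]_n * 'rV[R]_n) : R :=
  Lpow p (u z.1) (u z.2) * (eta z.1 - eta z.2) * K z.1 z.2.

Lemma measurable_weak_integrand (K : 'rV[R]_n -> 'rV[R]_n -> R) u eta :
  measurable_fun setT (fun z => K z.1 z.2) -> measurable_fun setT u ->
  measurable_fun setT eta -> measurable_fun setT (weak_integrand K u eta).
Proof.
move=> mK mu' meta.
have mB (f : 'rV[R]_n -> R) : measurable_fun setT f ->
    measurable_fun setT (fun z : 'rV[R]_n * 'rV[R]_n => f z.1 - f z.2).
  by move=> mf; apply: measurable_funB; exact: measurableT_comp.
apply: measurable_funM => //; apply: measurable_funM; last exact: mB.
apply: measurable_funM; last exact: mB.
apply: (measurableT_comp (measurable_powR _)); apply: measurableT_comp => //; exact: mB.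
Qed.

Lemma weak_integrand_swap K u eta z : K z.2 z.1 = K z.1 z.2 ->
  weak_integrand K u eta (z.2, z.1) = weak_integrand K u eta z.
Proof. by move=> Kz; rewrite /weak_integrand/= Lpow_sym Kz; ring. Qed.

End weak_form.

Section obstacle.
Context (R : realType) (n : nat) (s p Lam : R).
Context (K : 'rV[R]_n -> 'rV[R]_n -> R).
Context (Om Om' : set 'rV[R]_n) (h : 'rV[R]_n -> \bar R) (g u : 'rV[R]_n -> R).
Local Notation mu := (lebesgue_rV R n).
Local Notation mu2 := (mu \x mu)%E.
Hypothesis hs : 0 < s < 1.
Hypothesis hp : 1 < p.
Hypothesis hK : admissible_kernel s p Lam K.
Hypothesis openOm : open Om.
Hypothesis openOm' : open Om'.
Hypothesis bndOm' : bounded_set Om'.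
Hypothesis OmOm' : compactly_contained Om Om'.
Hypothesis hh : forall x, (h x < +oo)%E.
Hypothesis gT : tail_space s p g.
Hypothesis hu : obstacle_solution s p K g h Om Om' u.

Let p0 : 0 < p. Proof. exact: lt_trans hp. Qed.
Let s0 : 0 < s. Proof. by case/andP: hs. Qed.
Let mOm : measurable Om. Proof. exact: open_rV_measurable. Qed.
Let mOm' : measurable Om'. Proof. exact: open_rV_measurable. Qed.
Let subOm : Om `<=` Om'.
Proof. by apply: subset_trans OmOm'.2; exact: subset_closure. Qed.
Let uW : Wsp s p Om' u. Proof. by have [[]] := hu. Qed.
Let uh : {ae mu, forall x, Om x -> (h x <= (u x)%:E)%E}. Proof. by have [[]] := hu. Qed.
Let ug : {ae mu, forall x, ~ Om x -> u x = g x}. Proof. by have [[]] := hu. Qed.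

Let ug' : {ae mu, forall x, ~ Om' x -> u x = g x}.
Proof. by apply: filterS ug => x + Om'x; apply => /subOm. Qed.

Lemma obstacle_solution_tail : tail_space s p u.
Proof. exact: tail_space_patch ug'. Qed.

Lemma obstacle_solution_Wsp_loc U : U `<=` Om -> Wsp_loc s p U u.
Proof.
move=> UOm V oV [_ VU]; apply: (Wsp_subset p0 mOm') uW => //.
  exact: open_rV_measurable.
apply: subset_trans subOm; apply: subset_trans UOm; apply: subset_trans VU.
exact: subset_closure.
Qed.

(** On the support of eta the solution leaves a gap dlt above the obstacle, and
    a variation of size at most dlt cannot close it. *)
Lemma obstacle_class_variation (eta : 'rV[R]_n -> R) (c dlt : R) :
  Ck 1 eta -> (forall x, ~ Om x -> eta x = 0) ->
  {ae mu, forall x, eta x != 0 -> (h x + dlt%:E <= (u x)%:E)%E} ->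
  (forall x, Om x -> `|c * eta x| <= dlt) ->
  obstacle_class s p g h Om Om' (fun x => u x + c * eta x).
Proof.
move=> Ceta eta0 hd cd; split.
- by apply: (Wsp_add_scale p0 c mOm' uW); exact: (Ck1_Wsp p0 hs mOm' bndOm' Ceta).
- apply: filterS2 uh hd => x uhx hdx Omx.
  have [->|eta1] := eqVneq (eta x) 0; first by rewrite mulr0 addr0; exact: uhx.
  move: (hdx eta1) (cd _ Omx) (hh x); case: (h x) => [r|//|_ _ _]; last by rewrite leNye.
  by rewrite -EFinD !lee_fin => h1 h2 _; move: h2; rewrite ler_norml => /andP[h2 _]; lra.
- by apply: filterS ug => x ugx Omx; rewrite eta0// mulr0 addr0 ugx.
Qed.

(** The form of the obstacle problem, evaluated at a test function supported in
    Om, is the full double integral over the whole space: this is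
    integral_symmetric_split, since u = g a.e. outside Om'. The factor sg makes one
    statement serve sub- and supersolutions (sg = -1 and sg = 1), as both
    variations are admissible at a positive distance from the obstacle. *)
Lemma obstacle_variation_ge0 (eta : 'rV[R]_n -> R) (sg dlt : R) :
  Ck 1 eta -> (forall x, ~ Om x -> eta x = 0) -> 0 < dlt ->
  {ae mu, forall x, eta x != 0 -> (h x + dlt%:E <= (u x)%:E)%E} ->
  (0 <= \int[mu2]_z (weak_integrand p K u (fun x => sg * eta x) z)%:E)%E.
Proof.
move=> Ceta eta0 d0 hd.
have ceta : continuous eta by have [] := Ceta.
have [M M0 OmM] := bounded_sub_cube bndOm'.
have [B B0 HB] := continuous_bounded_cube M ceta.
(* The step eps is small enough for the variation to be at most dlt on Om. *)
pose eps := dlt / (`|sg| * B + 1).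
have B1 : 0 < `|sg| * B + 1 by rewrite ltr_wpDl// mulr_ge0.
have eps0 : 0 < eps by rewrite divr_gt0.
have epsd x : Om x -> `|eps * sg * eta x| <= dlt.
  move=> Omx; rewrite normrM (normrM eps) (gtr0_norm eps0) /eps -!mulrA ler_piMr ?(ltW d0)//.
  rewrite mulrC ler_pdivrMr// mul1r.
  by rewrite (@le_trans _ _ (`|sg| * B)) ?lerDl// ler_wpM2l//; apply/HB/OmM/subOm.
have := hu.2 _ (obstacle_class_variation Ceta eta0 hd epsd).
set psi := fun x => sg * eta x.
have -> : (fun x => u x + eps * sg * eta x - u x) = (fun x => eps * psi x).
  by apply/funext => x; rewrite /psi; ring.
have psi0 x : ~ Om x -> psi x = 0 by move=> Omx; rewrite /psi eta0// mulr0.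
have mpsi : measurable_fun setT psi.
  by apply: measurable_funM => //; exact: continuous_rV_measurable_fun.
(* From here on K and u are replaced by Borel versions Kb and ub. *)
have [_ Ksym mK _] := hK.
have [Kb mKb KE] := completed_measurable_fun_borel measurableT mK.
have [uT _ _] := obstacle_solution_tail.
have [ub mub uE] := completed_measurable_fun_borel measurableT uT.
have {}KE : {ae mu2, forall z, K z.1 z.2 = Kb z} by apply: filterS KE => z; exact.
have {}uE : {ae mu, forall x, u x = ub x} by apply: filterS uE => x; exact.
pose K' x y := Kb (x, y).
have mK' : measurable_fun setT (fun z => K' z.1 z.2).
  by rewrite (_ : (fun _ => _) = Kb)//; apply/funext => -[].
pose F z := weak_integrand p K' ub psi z.
have mF : measurable_fun setT F by exact: measurable_weak_integrand.
have FE : {ae mu2, forall z, weak_integrand p K u psi z = F z}.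
  apply: filterS3 KE (ae_fst mu uE) (ae_snd mu uE) => -[x y] /= KE1 u1 u2.
  by rewrite /F /weak_integrand/= KE1 u1 u2.
have Fs : {ae mu2, forall z, F (z.2, z.1) = F z}.
  apply: filterS2 KE (ae_swap KE) => -[x y] /= K1 K2.
  by apply: (@weak_integrand_swap _ _ _ _ _ _ (x, y)); rewrite /K'/= -K1 -K2.
have F0 z : ~ Om z.1 -> ~ Om z.2 -> F z = 0.
  by move=> z1 z2; rewrite /F /weak_integrand !psi0// subrr mulr0 mul0r.
rewrite (ae_eq_lower_integral (g := fun z => (F z)%:E)); last first.
  by apply: filterS FE => z -> _.
have mEF : measurable_fun setT (EFin \o F) by exact/measurable_EFinP.
rewrite /Aform.
rewrite (ae_eq_lower_integral (D := Om' `*` Om') (g := fun z => (eps%:E * (F z)%:E)%E)); last first.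
  by apply: filterS FE => z <- _; rewrite -EFinM /weak_integrand; congr (_%:E); ring.
rewrite (ae_eq_lower_integral (D := Om `*` ~` Om') (g := fun z => (eps%:E * (F z)%:E)%E)); last first.
  apply: filterS2 FE (ae_snd mu ug') => -[x y] /= <- gy [/= Omx Omy].
  rewrite -EFinM /weak_integrand/= -gy// (psi0 y) => [|/subOm//]; congr (_%:E); ring.
rewrite -(integral_symmetric_split (f := fun z => (eps%:E * (F z)%:E)%E) mOm mOm' subOm); last 3 first.
- by apply/measurable_EFinP; exact: measurable_funM.
- by apply: filterS Fs => z ->.
- by move=> z z1 z2; rewrite F0// mule0.
by rewrite integralZl_gt0// pmule_rge0// lte_fin.
Qed.

Lemma obstacle_solution_weak_solution (U : set 'rV[R]_n) : open U -> U `<=` Om ->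
  (forall eta, test_function U eta -> exists2 dlt, 0 < dlt &
     {ae mu, forall x, eta x != 0 -> (h x + dlt%:E <= (u x)%:E)%E}) ->
  weak_solution s p K U u.
Proof.
move=> oU UOm H.
have key (eta : 'rV[R]_n -> R) (sg : R) : test_function U eta ->
    (0 <= \int[mu2]_z (weak_integrand p K u (fun x => sg * eta x) z)%:E)%E.
  move=> teta; have [dlt d0 hd] := H _ teta.
  have [Ceta [_ sup]] := teta.
  apply: (obstacle_variation_ge0 _ (Ceta 1%N) _ d0 hd) => x Omx.
  apply/eqP/negPn/negP => etax; apply: Omx; apply/UOm/sup.
  exact: subset_closure.
split; split; [exact: oU| | | |exact: oU| | |].
- move=> V oV VU; apply: (WspN p0 (open_rV_measurable oV)).
  exact: (obstacle_solution_Wsp_loc UOm oV VU).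
- exact/tail_spaceN/obstacle_solution_tail.
(* The integrand is odd in u and linear in the test function. *)
- move=> eta teta _; have := key eta (-1) teta; congr (_ <= _)%E.
  apply: eq_integral => z _; congr (_%:E).
  by rewrite /weak_integrand LpowNN; ring.
- exact: (obstacle_solution_Wsp_loc UOm).
- exact: obstacle_solution_tail.
- move=> eta teta _; have := key eta 1 teta; congr (_ <= _)%E.
  apply: eq_integral => z _; congr (_%:E).
  by rewrite /weak_integrand; ring.
Qed.

Lemma ess_inf_on_gt0_gap (D : set 'rV[R]_n) :
  (0 < ess_inf_on mu D (fun x => (u x)%:E - h x))%E ->
  exists2 dlt, 0 < dlt & {ae mu, forall x, D x -> (h x + dlt%:E <= (u x)%:E)%E}.
Proof.
move=> /ereal_sup_gt[y /= Hy y0].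
have [dlt d0 dy] : exists2 d : R, 0 < d & (d%:E <= y)%E.
  case: y y0 {Hy} => [r| |]//; first by rewrite lte_fin; exists r.
  by exists 1 => //; rewrite leey.
exists dlt => //; apply: filterS Hy => x + Dx => /(_ Dx) /(le_trans dy).
move: (hh x); case: (h x) => [r| |]//= _; last by rewrite leNye.
by rewrite -EFinB -EFinD !lee_fin => ?; lra.
Qed.

Lemma lsc_on_near (f : 'rV[R]_n -> \bar R) x (a : R) : lsc_on Om f -> Om x ->
  (a%:E < f x)%E -> \forall y \near x, (a%:E < f y)%E.
Proof.
move=> lf Omx /lf[V nV HV]; move: nV; rewrite {1}/nbhs/= -nbhs_subspace_in//.
move=> nV; have nOm : nbhs x Om by exact: open_nbhs_nbhs.
by apply: filterS2 nOm nV => y Omy /(_ Omy)/HV.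
Qed.

Section semicontinuous.
Hypothesis ulsc : lsc_on Om (fun x => (u x)%:E).
Hypothesis husc : usc_on Om h.

(** With h x < a < b < u x, semicontinuity keeps h below a and u above b near x,
    so that b - a is a gap. *)
Lemma semicontinuous_gap x : Om x -> (h x < (u x)%:E)%E ->
  exists2 dlt, 0 < dlt & \forall y \near x, (h y + dlt%:E <= (u y)%:E)%E.
Proof.
move=> Omx hux.
have [a ha au] : exists2 a : R, (h x < a%:E)%E & a < u x.
  move: hux; case: (h x) => [r| |]//.
    rewrite lte_fin => ru; exists ((r + u x) / 2); rewrite ?lte_fin; lra.
  by exists (u x - 1); [exact: ltNyr|lra].
pose b := (a + u x) / 2.
have bu : (b%:E < (u x)%:E)%E by rewrite lte_fin /b; lra.
have na : ((- a)%:E < - h x)%E by rewrite EFinN lteN2.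
exists (b - a); first by rewrite /b; lra.
apply: filterS2 (lsc_on_near ulsc Omx bu) (lsc_on_near husc Omx na) => y.
rewrite lte_fin EFinN lteN2; case: (h y) => [r|//|_ _]; last by rewrite leNye.
by rewrite lte_fin -EFinD lee_fin => ? ?; lra.
Qed.

Lemma open_noncontact : open [set x | Om x /\ (h x < (u x)%:E)%E].
Proof.
rewrite openE => x [Omx hux]; have [dlt d0 Hd] := semicontinuous_gap Omx hux.
have nOm : nbhs x Om by exact: open_nbhs_nbhs.
rewrite /interior/=; apply: filterS2 nOm Hd => y Omy hy; split => //.
move: hy (hh y); case: (h y) => [r|//|_ _]; last exact: ltNyr.
by rewrite -EFinD lee_fin lte_fin => ? _; lra.
Qed.

(** The gap is locally uniform near each noncontact point by semicontinuity, and
    a compact set is covered by finitely many such neighbourhoods. *)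
Lemma compact_gap (C : set 'rV[R]_n) : compact C ->
  C `<=` [set x | Om x /\ (h x < (u x)%:E)%E] ->
  exists2 dlt, 0 < dlt & forall x, C x -> (h x + dlt%:E <= (u x)%:E)%E.
Proof.
move=> /compact_near_coveringP cC CP.
have := cC R (0^'+) (fun dlt x => (h x + dlt%:E <= (u x)%:E)%E) _.
have H x : C x -> \forall x' \near x & i \near 0^'+, (h x' + i%:E <= (u x')%:E)%E.
  move=> /CP[Omx hux]; have [d d0 Hd] := semicontinuous_gap Omx hux.
  exists ([set y | (h y + d%:E <= (u y)%:E)%E], [set e | e <= d]) => /=.
    by split => //; exact: nbhs_right_le.
  move=> [y e] /= [hy ed]; apply: le_trans hy.
  by apply: leeD2l; rewrite lee_fin.
move=> /(_ (at_right_proper_filter 0) H) Hn; near (0 : R)^'+ => dlt.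
exists dlt => //.
by near: dlt.
Unshelve. all: by end_near. Qed.

End semicontinuous.
End obstacle.

Theorem corollary1 (R : realType) (n : nat) (s p Lam : R)
    (K : 'rV[R]_n -> 'rV[R]_n -> R)
    (Om Om' : set 'rV[R]_n) (h : 'rV[R]_n -> \bar R) (g u : 'rV[R]_n -> R)
    (hs : 0 < s < 1) (hp : 1 < p) (hLam : 1 <= Lam)
    (hK : admissible_kernel s p Lam K)
    (openOm : open Om) (openOm' : open Om')
    (bndOm : bounded_set Om) (bndOm' : bounded_set Om')
    (OmOm' : compactly_contained Om Om')
    (hh : forall x, (h x < +oo)%E)
    (gW : Wsp s p Om' g) (gT : tail_space s p g)
    (nonempty : obstacle_class s p g h Om Om' !=set0)
    (hu : obstacle_solution s p K g h Om Om' u) :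
  (forall (x0 : 'rV[R]_n) (r : R), 0 < r -> eball x0 r `<=` Om ->
     (0 < ess_inf_on (lebesgue_rV R n) (eball x0 r)
            (fun x => (u x)%:E - h x))%E ->
     weak_solution s p K (eball x0 r) u) /\
  (lsc_on Om (fun x => (u x)%:E) -> usc_on Om h ->
     weak_solution s p K [set x | Om x /\ (h x < (u x)%:E)%E] u).
Proof.
split=> [x0 r _ bOm gap|ulsc husc].
  apply: (obstacle_solution_weak_solution hs hp hK openOm openOm' bndOm' OmOm' hh gT hu) => //.
    exact: open_eball.
  move=> eta [_ [_ sup]]; have [dlt d0 Hd] := ess_inf_on_gt0_gap hh gap.
  exists dlt => //; apply: filterS Hd => x Hx etax; apply: Hx.
  exact/sup/subset_closure.
apply: (obstacle_solution_weak_solution hs hp hK openOm openOm' bndOm' OmOm' hh gT hu).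
- exact: open_noncontact.
- by move=> x [].
- move=> eta [_ [ceta sup]].
  have [dlt d0 Hd] := compact_gap openOm ulsc husc ceta sup.
  exists dlt => //; apply: aeW => x etax; apply: Hd; exact: subset_closure.
Qed.
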